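(* Fix $\kappa > \kappa^*$. Let $\alpha = \kappa 2^k\log k/k$ and $m=\lfloor \alpha n\rfloor$. There exists $k^*=k^*(\kappa)>0$ such that for any $k\ge k^*$ there exist $\eta=\Omega_k(k^{-2})$ (depending on $\kappa,k$) and $\nu=\frac{1}{k^22^k}$ such that the following holds. For all $r\in\mathbb N$ there exists $n^*>0$ (depending on $\kappa,k,r$) such that if $n\ge n^*$, then for any $r$-local algorithm $\mathcal A$ with output in $\{\mathtt T,\mathtt F\}^n$, \[ \mathbb P[\mathcal A(\Phi) \text{ } (\eta,\nu)\text{-satisfies } \Phi] \le \exp(-\widetilde\Omega(n^{1/3})), \] where the probability is over $\Phi\sim\Phi_k(n,m)$ and the independent internal randomness of $\mathcal A$.
   Context: Random $k$-SAT: literals $\mathcal{L}=\{x_1,\dots,x_n,\bar x_1,\dots,\bar x_n\}$; $\Omega_k(n,m)$ = ordered $m$-tuples of clauses, each an ordered $k$-tuple of literals; $\Phi_k(n,m)$ = uniform on $\Omega_k(n,m)$ (i.i.d. uniform literals). $x\in\{\mathtt T,\mathtt F\}^n$ $\nu$-satisfies $\Phi$ if it satisfies at least $(1-\nu)m$ clauses; $x$ $(\eta,\nu)$-satisfies $\Phi$ if some $y\in\{\mathtt T,\mathtt F\}^n$ with normalized Hamming distance $\Delta(x,y)\le\eta$ $\nu$-satisfies $\Phi$. $\iota(\beta)=\beta/(1-\beta e^{-(\beta-1)})$ on $(1,\infty)$, $\kappa^*=\min\iota\approx4.911$. Factor graph of $\Phi$: bipartite graph $G$ with variable vertices $v_1,\dots,v_n$,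 clause vertices $c_1,\dots,c_m$, an edge $(v_j,c_i)$ for each occurrence of $x_j$ or $\bar x_j$ in clause $i$, and polarity $\rho(e)=\mathtt T$ for $x_j$, $\mathtt F$ for $\bar x_j$. A decorated bipartite graph is $(G,\rho,\varphi)$ with $\rho:E_G\to\{\mathtt T,\mathtt F\}$, $\varphi:V_G\cup E_G\to\Omega$ for a probability space $(\Omega,\mathbb P_\omega)$; rooted if a vertex $v$ is marked. The $r$-neighborhood $N_r(v,G,\rho,\varphi)$ is the subgraph of vertices reachable from $v$ by paths of length $\le r$ and edges on those paths, with restricted decorations and root $v$. A function $f$ on rooted decorated bipartite graphs is $r$-local if $f(v,G,\rho,\varphi)$ depends only on the isomorphism class (preserving root, vertex sides, edges, $\rho,\varphi$) of $N_r(v,G,\rho,\varphi)$. The $r$-local algorithm based on an $r$-local $f$ with codomain $\{\mathtt T,\mathtt F\}$: on input $\Phi$ with factor graph $(G,\rho)$, sample $\varphi\sim(\Omega,\mathbb P_\omega)^{\otimes(V_G\cup E_G)}$ independently of $\Phi$ and output $x_i=f(v_i,G,\rho,\varphi)$. Notation: $\widetilde\Omega(n^{1/3})$ means at least $c\,n^{1/3}/\mathrm{polylog}(n)$ for some $c>0$ that may depend on $\kappa,k,r$; $\Omega_k(k^{-2})$ means a quantity independent of $n$ at least $c/k^2$ for a constant $c>0$. *)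

(* Defs.v *)
From HB Require Import structures.
From mathcomp Require Import all_boot all_order all_algebra.
From mathcomp Require Import all_classical all_reals all_analysis.

Set Implicit Arguments.
Unset Strict Implicit.
Unset Printing Implicit Defensive.

Import Order.TTheory GRing.Theory Num.Theory.

Local Open Scope classical_set_scope.
Local Open Scope ring_scope.

(* (j, true) is the literal x_j and (j, false) is its negation. *)
Definition literal (n : nat) : finType := ('I_n * bool)%type.

Definition clause (k n : nat) : finType := (k.-tuple (literal n))%type.

Definition formula (k n m : nat) : finType := (m.-tuple (clause k n))%type.

Definition assignment (n : nat) : finType := {ffun 'I_n -> bool}.

Section satisfaction.
Context {R : realType} {k n m : nat}.
Implicit Types (x y : assignment n) (Phi : formula k n m).

Definition literal_sat x (l : literal n) : bool := x l.1 == l.2.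

Definition clause_sat x (c : clause k n) : bool := has (literal_sat x) c.

Definition nsat x Phi : nat := #|[pred i : 'I_m | clause_sat x (tnth Phi i)]|.

Definition nu_satisfies (nu : R) x Phi : bool :=
  (1 - nu) * m%:R <= (nsat x Phi)%:R :> R.

Definition hamming x y : R := #|[pred i : 'I_n | x i != y i]|%:R / n%:R.

Definition eta_nu_satisfies (eta nu : R) x Phi : bool :=
  [exists y : assignment n, (hamming x y <= eta) && nu_satisfies nu y Phi].

End satisfaction.

Section threshold.
Context {R : realType}.

Definition iota_fun (b : R) : R := b / (1 - b * expR (- (b - 1))).

(* The infimum is attained, iota_fun being continuous on (1, +oo) and tending
   to +oo at both ends. *)
Definition kappa_star : R := inf [set iota_fun b | b in [set b : R | 1 < b]].

End threshold.

(* Finite bipartite multigraphs with polarities. Edges are a type of their own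
   since a variable may occur several times in a clause. *)
Record bgraph := BGraph {
  gvar : finType;
  gcla : finType;
  gedge : finType;
  evar : gedge -> gvar;
  ecla : gedge -> gcla;
  pol : gedge -> bool }.

Definition vert (G : bgraph) : finType := (gvar G + gcla G)%type.

Record rdgraph (Om : Type) := RDGraph {
  rgraph :> bgraph;
  root : vert rgraph;
  deco : vert rgraph + gedge rgraph -> Om }.

Section walks.
Variable G : bgraph.
Implicit Types (u v w : vert G) (e : gedge G) (p : seq (gedge G)).

Definition joins e u w : bool :=
  [|| (u == inl (evar e)) && (w == inr (ecla e))
    | (u == inr (ecla e)) && (w == inl (evar e))].

Fixpoint walk u p w : bool :=
  if p is e :: p' then [exists u' : vert G, joins e u u' && walk u' p' w]
  else u == w.

(* Paths may repeat vertices; as the graph is bipartite, this does not change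
   the vertices and edges found on paths of length at most r. *)
Definition vert_within r v w : bool :=
  [exists s : 'I_r.+1, [exists p : s.-tuple (gedge G), walk v p w]].

Definition edge_within r v e : bool :=
  [exists s : 'I_r.+1, [exists p : s.-tuple (gedge G),
     (e \in (p : seq (gedge G))) && [exists w : vert G, walk v p w]]].

Lemma vert_withinI r v p w : (size p <= r)%N -> walk v p w -> vert_within r v w.
Proof.
move=> pr vpw; apply/existsP; exists (Ordinal (pr : (size p < r.+1)%N)).
by apply/existsP; exists (in_tuple p).
Qed.

Lemma vert_within0 r v : vert_within r v v.
Proof. by apply: (@vert_withinI r v [::]) => //=. Qed.

Lemma edge_within_ends r v e : edge_within r v e ->
  vert_within r v (inl (evar e)) /\ vert_within r v (inr (ecla e)).
Proof.
case/existsP=> s /existsP[p /andP[ep /existsP[w vpw]]].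
have: (size p <= r)%N by rewrite size_tuple -ltnS.
have suff_ q u : walk u q w -> e \in q ->
    exists q1 q2, [/\ (size q1 <= size q)%N, (size q2 <= size q)%N,
      walk u q1 (inl (evar e)) & walk u q2 (inr (ecla e))].
  elim: q u => [//|e' q IH] u /= /existsP[u' /andP[jn wq]].
  rewrite inE => /predU1P[ee'|eq]; last first.
    have [q1 [q2 [s1 s2 w1 w2]]] := IH _ wq eq.
    exists (e' :: q1), (e' :: q2); split => //=;
      by apply/existsP; exists u'; rewrite jn.
  move: jn; rewrite -ee' => /orP[]/andP[/eqP-> /eqP E].
    exists [::], [:: e]; split => //=.
    by apply/existsP; exists (inr (ecla e)); rewrite /joins !eqxx.
  exists [:: e], [::]; split => //=.
  by apply/existsP; exists (inl (evar e)); rewrite /joins !eqxx orbT.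
have [q1 [q2 [s1 s2 w1 w2]]] := suff_ _ _ vpw ep => pr.
split; [exact: vert_withinI (leq_trans s1 pr) w1|
        exact: vert_withinI (leq_trans s2 pr) w2].
Qed.

End walks.

Section neighborhood.
Context {Om : Type}.
Variables (r : nat) (G : rdgraph Om).

Let V1 := {x : gvar G | vert_within r (root G) (inl x)}.
Let V2 := {c : gcla G | vert_within r (root G) (inr c)}.
Let E := {e : gedge G | edge_within r (root G) e}.

Definition nbhd_bgraph : bgraph := @BGraph V1 V2 E
  (fun e => exist _ (evar (val e)) (edge_within_ends (valP e)).1)
  (fun e => exist _ (ecla (val e)) (edge_within_ends (valP e)).2)
  (fun e => pol (val e)).

Definition nbhd_vert (v : vert G) :
    vert_within r (root G) v -> vert nbhd_bgraph :=
  match v with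
  | inl x => fun h => inl (exist _ x h)
  | inr c => fun h => inr (exist _ c h)
  end.

Definition nbhd_val (a : vert nbhd_bgraph + gedge nbhd_bgraph) :
    vert G + gedge G :=
  match a with
  | inl (inl x) => inl (inl (val x))
  | inl (inr c) => inl (inr (val c))
  | inr e => inr (val e)
  end.

Definition nbhd : rdgraph Om := @RDGraph Om nbhd_bgraph
  (nbhd_vert (vert_within0 r (root G))) (fun a => deco (nbhd_val a)).

End neighborhood.

Definition rd_iso {Om : Type} (G H : rdgraph Om) : Prop :=
  exists (a : gvar G -> gvar H) (b : gcla G -> gcla H)
         (c : gedge G -> gedge H),
  let ab (v : vert G) : vert H :=
    match v with inl x => inl (a x) | inr y => inr (b y) end in
  [/\ [/\ bijective a, bijective b & bijective c],
      (forall e, [/\ evar (c e) = a (evar e), ecla (c e) = b (ecla e)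
                   & pol (c e) = pol e]),
      ab (root G) = root H,
      (forall v, deco (inl (ab v) : vert H + gedge H) = deco (inl v))
    & (forall e, deco (inr (c e) : vert H + gedge H) = deco (inr e))].

Definition r_local {Om T : Type} (r : nat) (f : rdgraph Om -> T) : Prop :=
  forall G H : rdgraph Om, rd_iso (nbhd r G) (nbhd r H) -> f G = f H.

(* The edge (i, j) stands for the j-th literal of the i-th clause. *)
Definition factor_graph (k n m : nat) (Phi : formula k n m) : bgraph :=
  @BGraph 'I_n 'I_m ('I_m * 'I_k)%type
    (fun e => (tnth (tnth Phi e.1) e.2).1) fst
    (fun e => (tnth (tnth Phi e.1) e.2).2).

(* V_G + E_G for the factor graph G; it does not depend on the formula. *)
Definition deco_index (k n m : nat) : finType :=
  (('I_n + 'I_m) + ('I_m * 'I_k))%type.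

Section algorithm.
Context {Om : Type} {k n m : nat}.

(* The decoration phi is presented as the tuple of its values. *)
Definition algorithm_output (f : rdgraph Om -> bool) (Phi : formula k n m)
    (phi : #|deco_index k n m|.-tuple Om) : assignment n :=
  [ffun i => f (@RDGraph Om (factor_graph Phi) (inl i)
                 (fun a => tnth phi (enum_rank (a : deco_index k n m))))].

End algorithm.

Section product_power.
Context d {T : measurableType d} {R : realType}.

Definition tcons (N : nat) (z : T * N.-tuple T) : N.+1.-tuple T :=
  [tuple of z.1 :: z.2].

Lemma measurable_tcons N : measurable_fun setT (@tcons N).
Proof. exact: measurable_cons. Qed.

HB.instance Definition _ N :=
  @isMeasurableFun.Build _ _ _ _ (@tcons N) (@measurable_tcons N).

Fixpoint product_power (P : probability T R) (N : nat) :
    probability (N.-tuple T) R :=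
  match N with
  | 0 => dirac [tuple]
  | N'.+1 => distribution (P \x product_power P N')%E (@tcons N')
  end.

End product_power.

(* Phi is uniform on the finite set Omega_k(n, m) and independent of the
   decorations, so the joint law is the product of the two. *)
Definition success_probability {d} {Om : measurableType d} {R : realType}
    (P : probability Om R) (k n m : nat) (eta nu : R) (f : rdgraph Om -> bool) :
    \bar R :=
  (\sum_(Phi : formula k n m) (#|formula k n m|%:R^-1)%:E *
     product_power P #|deco_index k n m|
       [set phi | eta_nu_satisfies eta nu (algorithm_output f Phi phi) Phi])%E.

(* The success event is only an event if the output depends measurably on the
   internal randomness. *)
Definition measurable_output {d} {Om : measurableType d} (k n m : nat)
    (f : rdgraph Om -> bool) : Prop :=
  forall (Phi : formula k n m) (i : 'I_n),
    measurable_fun setT (fun phi => algorithm_output f Phi phi i).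

(* Main.v *)
Require Import Defs.
From mathcomp Require Import all_boot all_order all_algebra.
From mathcomp Require Import all_classical all_reals all_analysis.
From mathcomp Require Import measurable_realfun zify ring lra.

Set Implicit Arguments.
Unset Strict Implicit.
Unset Printing Implicit Defensive.

Import Order.TTheory GRing.Theory Num.Theory.

(* The decorations phi are fixed throughout: for every phi the output is a map
   A from formulas to assignments such that A(Phi)_i depends only on the labelled
   r-neighbourhood of i, and the success probability over the formula alone is
   at most exp(- c n).

   Split the clauses into K blocks and interpolate, one block at a time, through
   L + 1 independent copies of the formula. By a Sidorenko-type inequality all
   formulas on the path succeed with probability at least p^((L + 1)^K), where p
   is the success probability, and K, L do not depend on n. Consecutive outputs
   differ in few places since neighbourhoods of small sets of variables are small,
   up to exponentially small probability.

   Along the path, measure how well an assignment y is predicted from previous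
   ones y_0, ..., y_l by the smallest logarithmic loss of a predictor of y(i) from
   y_0(i), ..., y_l(i). It is Lipschitz in y; it starts near 0, and once all blocks
   are renewed it is large, as few assignments have small loss and the formula
   is independent of the past. Hence one finds a ladder y_0, ..., y_L of
   assignments, each with loss in a window around beta ln k / k given the previous
   ones. Each rung multiplies the number of ladders by about
   exp(n beta ln k / k), but a Chernoff bound shows that it also forces fresh
   violated clauses with probability 2^-k (1 - beta exp(1 - beta)), which costs
   exp(- kappa (1 - beta exp(1 - beta)) n ln k / k). As iota(beta) < kappa the
   first moment is exponentially small for L of order k / ln k. *)

Local Open Scope ring_scope.

Section average.
Context {R : realType}.

Definition avg (T : finType) (F : T -> R) : R := (\sum_x F x) / #|T|%:R.

Lemma eq_avg (T : finType) (F G : T -> R) : F =1 G -> avg F = avg G.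
Proof. by move=> FG; rewrite /avg (eq_bigr G). Qed.

Lemma le_avg (T : finType) (F G : T -> R) : (forall x, F x <= G x) -> avg F <= avg G.
Proof. by move=> FG; rewrite ler_wpM2r ?invr_ge0 ?ler0n// ler_sum. Qed.

Lemma avg_ge0 (T : finType) (F : T -> R) : (forall x, 0 <= F x) -> 0 <= avg F.
Proof. by move=> F0; rewrite divr_ge0 ?ler0n// sumr_ge0. Qed.

Lemma avg_cst (T : finType) (c : R) : (0 < #|T|)%N -> avg (fun _ : T => c) = c.
Proof.
move=> T0; rewrite /avg sumr_const -[c *+ _]mulr_natr mulfK//.
by rewrite pnatr_eq0 -lt0n.
Qed.

Lemma avg_le_cst (T : finType) (F : T -> R) (c : R) :
  0 <= c -> (forall x, F x <= c) -> avg F <= c.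
Proof.
move=> c0 Fc; have [T0|T0] := posnP #|T|.
  by rewrite /avg T0 invr0 mulr0.
by rewrite -[leRHS](avg_cst c T0) le_avg.
Qed.

Lemma avgD (T : finType) (F G : T -> R) : avg (fun x => F x + G x) = avg F + avg G.
Proof. by rewrite /avg big_split mulrDl. Qed.

Lemma avgZ (T : finType) (c : R) (F : T -> R) : avg (fun x => c * F x) = c * avg F.
Proof. by rewrite /avg -mulr_sumr mulrA. Qed.

Lemma avg_sum (T I : finType) (F : I -> T -> R) :
  avg (fun x => \sum_i F i x) = \sum_i avg (F i).
Proof. by rewrite /avg exchange_big /= mulr_suml. Qed.

Lemma avgB (T : finType) (F G : T -> R) : avg (fun x => F x - G x) = avg F - avg G.
Proof. by rewrite /avg sumrB mulrBl. Qed.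

Lemma avg_bij (T U : finType) (h : T -> U) (F : U -> R) :
  bijective h -> avg (fun x => F (h x)) = avg F.
Proof.
move=> bh; rewrite /avg (bij_eq_card bh); congr (_ / _).
by rewrite [RHS](reindex h)//; exact: onW_bij.
Qed.

Lemma avg_pair (T U : finType) (F : T -> U -> R) :
  avg (fun p : T * U => F p.1 p.2) = avg (fun x => avg (F x)).
Proof.
rewrite /avg -mulr_suml pair_bigA/= card_prod natrM invfM.
by rewrite mulrA [RHS]mulrAC.
Qed.

Lemma avg_swap (T U : finType) (h : T -> U -> T) (g : T -> U -> U) (F : T -> R) :
  (0 < #|U|)%N -> involutive (fun p : T * U => (h p.1 p.2, g p.1 p.2)) ->
  avg (fun x => avg (fun y => F (h x y))) = avg F.
Proof.
move=> U0 hg; rewrite -avg_pair.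
rewrite (avg_bij (fun p : T * U => F p.1) (inv_bij hg)).
by rewrite (avg_pair (fun x _ => F x)); apply: eq_avg => x; rewrite avg_cst.
Qed.

Lemma avg_ffun_prod (I T : finType) (F : I -> T -> R) :
  avg (fun f : {ffun I -> T} => \prod_i F i (f i)) = \prod_i avg (F i).
Proof.
rewrite /avg big_split/= bigA_distr_bigA/= prodr_const card_ffun natrX.
by rewrite -exprVn.
Qed.

Lemma avg_tuple_prod (m : nat) (T : finType) (F : 'I_m -> T -> R) :
  avg (fun t : m.-tuple T => \prod_i F i (tnth t i)) = \prod_i avg (F i).
Proof.
rewrite -avg_ffun_prod -(avg_bij (h := fun f : {ffun 'I_m -> T} => [tuple f i | i < m])).
  by apply: eq_avg => f; apply: eq_bigr => i _; rewrite tnth_mktuple.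
exists (fun t : m.-tuple T => [ffun i => tnth t i]) => [f|t].
  by apply/ffunP => i; rewrite ffunE tnth_mktuple.
by apply: eq_from_tnth => i; rewrite tnth_mktuple ffunE.
Qed.

Lemma exp_tangent (N : nat) (x a : R) : 0 <= x -> 0 <= a ->
  a ^+ N.+1 + N.+1%:R * a ^+ N * (x - a) <= x ^+ N.+1.
Proof.
move=> x0 a0; elim: N => [|N IH]; first by rewrite expr0 !expr1; lra.
rewrite [leRHS]exprS; apply: le_trans (ler_wpM2l x0 IH).
rewrite -subr_ge0.
set d := (X in 0 <= X).
have -> : d = N.+1%:R * a ^+ N * (x - a) ^+ 2.
  by rewrite /d !exprS -(natr1 N.+1); ring.
by rewrite mulr_ge0 ?sqr_ge0// mulr_ge0 ?ler0n ?exprn_ge0.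
Qed.

Lemma avg_pow (T : finType) (N : nat) (F : T -> R) :
  (0 < #|T|)%N -> (forall x, 0 <= F x) -> avg F ^+ N <= avg (fun x => F x ^+ N).
Proof.
move=> T0 F0; case: N => [|N]; first by rewrite expr0 avg_cst.
have a0 := avg_ge0 F0; set a := avg F in a0 *.
apply: le_trans (le_avg (fun x => exp_tangent N (F0 x) a0)).
by rewrite avgD avg_cst// avgZ avgB avg_cst// subrr mulr0 addr0.
Qed.

End average.

Section interpolation.
Context {R : realType} {k n m K L : nat}.
Hypothesis form_gt0 : (0 < #|formula k n m|)%N.
Variable blk : 'I_m -> 'I_K.

Let Omega : finType := {ffun 'I_L.+1 -> formula k n m}.
Let choices : finType := {ffun 'I_K -> 'I_L.+1}.

Definition mix (c : {ffun 'I_K -> 'I_L.+1}) (Psi : {ffun 'I_L.+1 -> formula k n m}) :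
    formula k n m :=
  [tuple tnth (Psi (c (blk i))) i | i < m].

Lemma copies_gt0 : (0 < #|Omega|)%N.
Proof. by rewrite card_ffun expn_gt0 form_gt0. Qed.

Definition merge_copies (M : 'I_L.+1 -> 'I_m -> bool) (Psi Z : Omega) : Omega :=
  [ffun l => [tuple if M l i then tnth (Z l) i else tnth (Psi l) i | i < m]].

Lemma avg_merge M (F : Omega -> R) :
  avg (fun Psi => avg (fun Z => F (merge_copies M Psi Z))) = avg F.
Proof.
apply: (avg_swap (h := merge_copies M) (g := fun Psi Z => merge_copies M Z Psi)).
  exact: copies_gt0.
by move=> [Psi Z] /=; congr pair; apply/ffunP => l; apply: eq_from_tnth => i /=;
  rewrite !(ffunE, tnth_mktuple); case: (M l i).
Qed.

Lemma avg_mix (c : choices) (F : formula k n m -> R) :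
  avg (fun Psi => F (mix c Psi)) = avg F.
Proof.
pose h (Psi : Omega) (Phi : formula k n m) : Omega :=
  [ffun l => [tuple if l == c (blk i) then tnth Phi i else tnth (Psi l) i | i < m]].
rewrite -(avg_swap (h := h) (g := fun Psi _ => mix c Psi))//.
  transitivity (avg (fun _ : Omega => avg F)); last exact: avg_cst copies_gt0.
  apply: eq_avg => Psi; apply: eq_avg => Phi; congr F.
  by apply: eq_from_tnth => i; rewrite !(ffunE, tnth_mktuple) eqxx.
move=> [Psi Phi] /=; congr pair; last first.
  by apply: eq_from_tnth => i /=; rewrite !(ffunE, tnth_mktuple) eqxx.
apply/ffunP => l; apply: eq_from_tnth => i /=.
by rewrite !(ffunE, tnth_mktuple); case: eqP => [->|//].
Qed.

(* A Sidorenko-type inequality for complete K-partite hypergraphs: blocks are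
   duplicated one after the other, each time with Jensen's inequality for the
   power L + 1. *)
Lemma all_mix_lower_bound (A : pred (formula k n m)) :
  avg (fun Phi => (A Phi)%:R : R) ^+ (L.+1 ^ K) <=
  avg (fun Psi => [forall c, A (mix c Psi)]%:R : R).
Proof.
pose C (j : nat) (c : choices) := [forall b : 'I_K, (j <= b)%N ==> (c b == ord0)].
pose Q j (Psi : Omega) := [forall c, C j c ==> A (mix c Psi)].
have step j : (j <= K)%N ->
    avg (fun Phi => (A Phi)%:R : R) ^+ (L.+1 ^ j) <= avg (fun Psi => (Q j Psi)%:R : R).
  elim: j => [_|j IH jK].
    rewrite expn0 expr1 -(avg_mix [ffun=> ord0]); apply: le_avg => Psi.
    rewrite ler_nat; case: (boolP (A _)) => // AP.
    suff -> : Q 0%N Psi by [].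
    apply/forallP => c; apply/implyP => /forallP c0.
    suff -> : c = [ffun=> ord0] by [].
    by apply/ffunP => b; rewrite ffunE; apply/eqP; exact: c0.
  pose M (l : 'I_L.+1) (i : 'I_m) := blk i == Ordinal jK.
  pose ins (Psi : Omega) (z : formula k n m) : Omega :=
    [ffun l => if l == ord0 then
       [tuple if M l i then tnth z i else tnth (Psi l) i | i < m] else Psi l].
  have insE Psi Z z : Q j (ins (merge_copies M Psi Z) z) = Q j (ins Psi z).
    rewrite /Q; apply: eq_forallb => c; case: (boolP (C j c)) => //= /forallP cj.
    congr A; apply: eq_from_tnth => i; rewrite !(ffunE, tnth_mktuple).
    have [Mi|Mi] := boolP (blk i == Ordinal jK).
      have /eqP -> : c (blk i) == ord0 by apply: (implyP (cj _)); rewrite (eqP Mi).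
      by rewrite eqxx ?(ffunE, tnth_mktuple) /M Mi.
    by case: (c (blk i) == ord0); rewrite ?(ffunE, tnth_mktuple) /M (negbTE Mi).
  have mergeE Psi Z : Q j (merge_copies M Psi Z) = Q j (ins Psi (Z ord0)).
    rewrite /Q; apply: eq_forallb => c; case: (boolP (C j c)) => //= /forallP cj.
    congr A; apply: eq_from_tnth => i; rewrite !(ffunE, tnth_mktuple).
    have [Mi|Mi] := boolP (blk i == Ordinal jK).
      have /eqP -> : c (blk i) == ord0 by apply: (implyP (cj _)); rewrite (eqP Mi).
      by rewrite eqxx ?(ffunE, tnth_mktuple) /M Mi.
    by case: (c (blk i) == ord0); rewrite ?(ffunE, tnth_mktuple) /M (negbTE Mi).
  have QS (Psi : Omega) : [forall l, Q j (ins Psi (Psi l))] -> Q j.+1 Psi.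
    move=> /forallP QP; apply/forallP => c; apply/implyP => /forallP cj.
    have /forallP/(_ [ffun b => if b == Ordinal jK then ord0 else c b]) :=
      QP (c (Ordinal jK)).
    have -> /= : C j [ffun b => if b == Ordinal jK then ord0 else c b].
      apply/forallP => b; apply/implyP => jb; rewrite ffunE.
      have [//|bj] := eqVneq b (Ordinal jK).
      apply: (implyP (cj b)); rewrite ltn_neqAle jb andbT; apply/eqP => jb'.
      by move/eqP: bj; apply; apply: val_inj.
    congr A; apply: eq_from_tnth => i; rewrite !(ffunE, tnth_mktuple).
    have [bi|bi] := eqVneq (blk i) (Ordinal jK).
      by rewrite eqxx ?(ffunE, tnth_mktuple) /M bi eqxx.
    by case: eqP => [->|_]; rewrite ?(ffunE, tnth_mktuple) /M ?(negbTE bi).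
  have -> : avg (fun Phi => (A Phi)%:R : R) ^+ (L.+1 ^ j.+1) =
      (avg (fun Phi => (A Phi)%:R : R) ^+ (L.+1 ^ j)) ^+ L.+1.
    by rewrite -exprM expnSr.
  have p0 : 0 <= avg (fun Phi => (A Phi)%:R : R).
    by apply: avg_ge0 => Phi; rewrite ler0n.
  have p1 : 0 <= avg (fun Psi : Omega => (Q j Psi)%:R : R).
    by apply: avg_ge0 => Phi; rewrite ler0n.
  apply: (@le_trans _ _ (avg (fun Psi : Omega => (Q j Psi)%:R : R) ^+ L.+1)).
    by rewrite lerXn2r ?nnegrE ?exprn_ge0//; apply: IH; exact: ltnW.
  pose G (Psi : Omega) : R := avg (fun z : formula k n m => (Q j (ins Psi z))%:R).
  have -> : avg (fun Psi : Omega => (Q j Psi)%:R : R) = avg G.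
    rewrite -(avg_merge M); apply: eq_avg => Psi; rewrite /G.
    have Ec : (fun z : formula k n m => (Q j (ins Psi z))%:R : R) =1
        fun z => (Q j (ins Psi z))%:R * \prod_(l : 'I_L.+1 | l != ord0) 1.
      by move=> z; rewrite big1 ?mulr1.
    transitivity (avg (fun Z : Omega => \prod_l
      (if l == ord0 then (Q j (ins Psi (Z l)))%:R else 1) : R)).
      apply: eq_avg => Z; rewrite mergeE (bigD1 ord0)//= big1 ?mulr1//.
      by move=> l /negbTE ->.
    rewrite (avg_ffun_prod (fun l z => if l == ord0 then (Q j (ins Psi z))%:R else 1)).
    rewrite (bigD1 ord0)//= big1 ?mulr1//.
    by move=> l /negbTE ->; rewrite avg_cst.
  apply: le_trans (avg_pow _ copies_gt0 _) _.
    by move=> Psi; apply: avg_ge0 => z; rewrite ler0n.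
  rewrite -[leRHS](avg_merge M); apply: le_avg => Psi.
  have -> : G Psi ^+ L.+1 =
      avg (fun Z : Omega => \prod_l (Q j (ins Psi (Z l)))%:R : R).
    rewrite (avg_ffun_prod (fun l z => (Q j (ins Psi z))%:R)).
    by rewrite prodr_const card_ord.
  apply: le_avg => Z; rewrite -natr_prod ler_nat.
  have [/forallP QZ|] := boolP [forall l, Q j (ins Psi (Z l))].
    rewrite QS ?big1//; first by move=> l _; rewrite QZ.
    apply/forallP => l; rewrite insE.
    move: (QZ l); congr is_true.
    rewrite /Q; apply: eq_forallb => c; case: (boolP (C j c)) => //= /forallP cj.
    congr A; apply: eq_from_tnth => i; rewrite !(ffunE, tnth_mktuple).
    by case: (c (blk i) == ord0); rewrite ?(ffunE, tnth_mktuple) /M //;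
      case: (blk i == _).
  by rewrite negb_forall => /existsP[l /negbTE Ql]; rewrite (bigD1 l)//= Ql.
apply: le_trans (step K (leqnn _)) _; apply: le_avg => Psi; rewrite ler_nat.
case: (boolP (Q K Psi)) => // /forallP QP.
suff -> : [forall c, A (mix c Psi)] by [].
apply/forallP => c; apply: (implyP (QP c)); apply/forallP => b.
by rewrite leqNgt ltn_ord.
Qed.

End interpolation.

Section locality.
Context {k n m : nat}.
Implicit Types (Phi : formula k n m) (S D : {set 'I_n}).

Definition clause_var Phi (e : 'I_m * 'I_k) : 'I_n := (tnth (tnth Phi e.1) e.2).1.

Definition touches Phi (S : {set 'I_n}) (j : 'I_m) : bool :=
  [exists s, clause_var Phi (j, s) \in S].

Definition nbr Phi (S : {set 'I_n}) : {set 'I_n} :=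
  (S :|: [set clause_var Phi e | e in [set e : 'I_m * 'I_k | touches Phi S e.1]])%SET.

Lemma sub_nbr Phi S x : x \in S -> x \in nbr Phi S.
Proof. by move=> xS; rewrite finset.in_setU xS. Qed.

Lemma sub_iter_nbr Phi S j x : x \in S -> x \in iter j (nbr Phi) S.
Proof. by move=> xS; elim: j => //= j IH; exact: sub_nbr. Qed.

Lemma iter_nbr_le Phi S j d x : (j <= d)%N ->
  x \in iter j (nbr Phi) S -> x \in iter d (nbr Phi) S.
Proof. by move=> /subnK <-; rewrite iterD; exact: sub_iter_nbr. Qed.

Section two_formulas.
Variables (Phi Phi' : formula k n m) (ch : pred 'I_m) (S0 : {set 'I_n}).
Hypothesis same : forall j, ~~ ch j -> tnth Phi j = tnth Phi' j.
Hypothesis S0P : forall j s, ch j -> clause_var Phi (j, s) \in S0.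

Let far (d : nat) (u : 'I_n + 'I_m) : bool :=
  match u with
  | inl x => x \notin iter d (nbr Phi) S0
  | inr c => ~~ ch c && [forall s, clause_var Phi (c, s) \notin iter d (nbr Phi) S0]
  end.

Lemma far_step d (u u' : vert (factor_graph Phi)) (e : 'I_m * 'I_k) :
  far d.+1 u -> @joins (factor_graph Phi) e u u' -> ~~ ch e.1 /\ far d u'.
Proof.
move=> fu /orP[]/andP[/eqP uE /eqP u'E]; move: fu; rewrite uE u'E /=.
  rewrite -/(clause_var Phi e) => eN.
  have nch : ~~ ch e.1.
    apply: contra eN => ce; apply: (@sub_iter_nbr _ _ d.+1).
    by case: e {uE u'E} ce => j s; exact: S0P.
  split=> //; rewrite nch /=; apply/forallP => s; apply: contra eN => sN.
  rewrite finset.in_setU; apply/orP; right; apply/imsetP; exists e => //.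
  by rewrite finset.in_set; apply/existsP; exists s.
case/andP=> nch /forallP far_c; split=> //.
rewrite -/(clause_var Phi e); case: e {uE u'E} nch far_c => j s /= _ /(_ s).
by apply: contra; exact: sub_nbr.
Qed.

Lemma walk_transfer p (u w : 'I_n + 'I_m) :
  far (size p) u -> @walk (factor_graph Phi) u p w ->
  @walk (factor_graph Phi') u p w /\ (forall e, e \in p -> ~~ ch e.1).
Proof.
elim: p u => [|e p IH] u //= fu /existsP[u' /andP[jn wp]].
have [nch fu'] := far_step fu jn; have [wp' chp] := IH _ fu' wp.
split; last by move=> e'; rewrite inE => /predU1P[->|] //; exact: chp.
apply/existsP; exists u'; rewrite wp' andbT.
by move: jn; rewrite /joins /= -(same nch).
Qed.

Lemma vert_within_transfer r i w : i \notin iter r (nbr Phi) S0 ->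
  @vert_within (factor_graph Phi) r (inl i) w ->
  @vert_within (factor_graph Phi') r (inl i) w.
Proof.
move=> iN /existsP[s /existsP[p wp]]; apply/existsP; exists s; apply/existsP; exists p.
suff: far (size p) (inl i) by move=> /walk_transfer /(_ wp)[].
rewrite size_tuple /=; apply: contra iN.
by apply: iter_nbr_le; rewrite -ltnS.
Qed.

Lemma edge_within_transfer r i e : i \notin iter r (nbr Phi) S0 ->
  @edge_within (factor_graph Phi) r (inl i) e ->
  @edge_within (factor_graph Phi') r (inl i) e /\ ~~ ch e.1.
Proof.
move=> iN /existsP[s /existsP[p /andP[ep /existsP[w wp]]]].
have fi : far (size p) (inl i).
  rewrite size_tuple /=; apply: contra iN.
  by apply: iter_nbr_le; rewrite -ltnS.
have [wp' chp] := walk_transfer fi wp; split; last exact: chp.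
apply/existsP; exists s; apply/existsP; exists p; rewrite ep /=.
by apply/existsP; exists w.
Qed.

End two_formulas.

Lemma local_output {Om : Type} r (f : rdgraph Om -> bool) Phi Phi'
    (phi : #|deco_index k n m|.-tuple Om) (ch : pred 'I_m) (S0 : {set 'I_n}) i :
  r_local r f ->
  (forall j, ~~ ch j -> tnth Phi j = tnth Phi' j) ->
  (forall j s, ch j -> clause_var Phi (j, s) \in S0) ->
  (forall j s, ch j -> clause_var Phi' (j, s) \in S0) ->
  i \notin iter r (nbr Phi) S0 -> i \notin iter r (nbr Phi') S0 ->
  algorithm_output f Phi phi i = algorithm_output f Phi' phi i.
Proof.
move=> floc same S0P S0P' iN iN'; rewrite !ffunE; apply: floc.
have same' j : ~~ ch j -> tnth Phi' j = tnth Phi j by move=> /same ->.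
set G := RDGraph _ _; set H := RDGraph _ _.
have vGH w : @vert_within G r (inl i) w -> @vert_within H r (inl i) w.
  exact: (vert_within_transfer same S0P iN).
have vHG w : @vert_within H r (inl i) w -> @vert_within G r (inl i) w.
  exact: (vert_within_transfer same' S0P' iN').
have eGH e : @edge_within G r (inl i) e -> @edge_within H r (inl i) e.
  by case/(edge_within_transfer same S0P iN).
have eHG e : @edge_within H r (inl i) e -> @edge_within G r (inl i) e.
  by case/(edge_within_transfer same' S0P' iN').
have ech e : @edge_within G r (inl i) e -> ~~ ch e.1.
  by case/(edge_within_transfer same S0P iN).
exists (fun x => exist _ (val x) (vGH (inl (val x)) (valP x))).
exists (fun x => exist _ (val x) (vGH (inr (val x)) (valP x))).
exists (fun x => exist _ (val x) (eGH (val x) (valP x))).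
split.
- split.
  + exists (fun x => exist _ (val x) (vHG (inl (val x)) (valP x))) => x;
    exact: val_inj.
  + exists (fun x => exist _ (val x) (vHG (inr (val x)) (valP x))) => x;
    exact: val_inj.
  + exists (fun x => exist _ (val x) (eHG (val x) (valP x))) => x;
    exact: val_inj.
- move=> e; have sm := same _ (ech _ (valP e)).
  by split; rewrite /=; [apply: val_inj; rewrite /= sm|apply: val_inj|rewrite sm].
- by rewrite /=; congr inl; apply: val_inj.
- by case=> [x|c].
- by [].
Qed.

End locality.

Section expansion.
Context {R : realType} {k : nat}.
Implicit Types (n m r : nat) (eps sg alpha : R).

Lemma literal_gt0 n : (0 < n)%N -> (0 < #|literal n|)%N.
Proof. by move=> n0; rewrite card_prod card_ord card_bool muln_gt0 n0. Qed.

Lemma clause_gt0 n : (0 < n)%N -> (0 < #|clause k n|)%N.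
Proof. by move=> n0; rewrite card_tuple expn_gt0 literal_gt0. Qed.

Lemma formula_gt0 n m : (0 < n)%N -> (0 < #|formula k n m|)%N.
Proof. by move=> n0; rewrite card_tuple expn_gt0 clause_gt0. Qed.

Lemma avg_tuple_coord N (T : finType) (s : 'I_N) (G : T -> R) : (0 < #|T|)%N ->
  avg (fun t : N.-tuple T => G (tnth t s)) = avg G.
Proof.
move=> T0.
transitivity (avg (fun t : N.-tuple T =>
    \prod_i (if i == s then G (tnth t i) else 1))).
  apply: eq_avg => t; rewrite (bigD1 s)//= eqxx big1 ?mulr1//.
  by move=> i /negbTE ->.
rewrite (avg_tuple_prod (fun i x => if i == s then G x else 1)).
rewrite (bigD1 s)//= eqxx big1 ?mulr1// => i /negbTE ->.
by rewrite avg_cst.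
Qed.

Lemma prodr_expR (I : finType) (F : I -> R) :
  \prod_i expR (F i) = expR (\sum_i F i).
Proof. by rewrite (big_morph _ (@expRD R) (@expR0 R)). Qed.

Lemma card_nbr n m (Phi : formula k n m) S :
  (#|nbr Phi S| <= #|S| + k * #|[set j | touches Phi S j]%SET|)%N.
Proof.
apply: leq_trans (leq_card_setU _ _) _; rewrite leq_add2l.
apply: leq_trans (leq_imset_card _ _) _.
have -> : [set e : 'I_m * 'I_k | touches Phi S e.1]%SET =
    finset.setX [set j | touches Phi S j]%SET [set: 'I_k]%SET.
  by apply/setP => -[j s]; rewrite !(finset.in_setX, finset.in_set) andbT.
by rewrite cardsX cardsT card_ord mulnC.
Qed.

Lemma expansion_step alpha eps : 0 <= alpha -> 0 < eps ->
  exists2 sg : R, 0 < sg & forall n m, (0 < n)%N -> m%:R <= alpha * n%:R ->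
  avg (fun Phi : formula k n m => [exists S : {set 'I_n},
    (#|S|%:R <= sg * n%:R) && (eps * n%:R < #|nbr Phi S|%:R)]%:R : R)
  <= expR (- (n%:R / 2)).
Proof.
move=> alpha0 eps0.
pose mu : R := eps / (2 * k.+1%:R); have mu0 : 0 < mu by rewrite divr_gt0// mulr_gt0.
pose lam : R := 2 / mu; have lam0 : 0 < lam by rewrite divr_gt0.
pose q : R := 2 * (alpha + 1) * k.+1%:R * expR lam.
have q0 : 0 < q by rewrite !mulr_gt0 ?expR_gt0// ltr_wpDl.
pose sg := Num.min (eps / 2) q^-1.
have sg0 : 0 < sg by rewrite lt_min divr_gt0//= invr_gt0.
exists sg => // n m n0 mn.
have nR0 : (0 : R) < n%:R by rewrite ltr0n.
pose ev (S : {set 'I_n}) (Phi : formula k n m) : R :=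
  ((#|S|%:R <= sg * n%:R) && (eps * n%:R < #|nbr Phi S|%:R))%:R.
have evS S : avg (ev S) <= expR (- (3 / 2 * n%:R)).
  rewrite /ev; case: (boolP (#|S|%:R <= _)) => Ssg /=; last first.
    by rewrite (le_trans _ (expR_ge0 _))// avg_le_cst.
  pose tc (c : clause k n) : R := [exists s, (tnth c s).1 \in S]%:R.
  apply: (@le_trans _ _ (avg (fun Phi : formula k n m =>
      expR (- (2 * n%:R)) * \prod_j expR (lam * tc (tnth Phi j))))).
    apply: le_avg => Phi; case: ltP => [lt_nbr|_]; last first.
      by rewrite mulr_ge0 ?expR_ge0// prodr_ge0// => j _; exact: expR_ge0.
    rewrite prodr_expR -expRD -mulr_sumr.
    have -> : \sum_j tc (tnth Phi j) = #|[set j | touches Phi S j]%SET|%:R.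
      rewrite -sum1_card natr_sum [RHS]big_mkcond/=; apply: eq_bigr => j _.
      by rewrite finset.in_set /tc /touches /clause_var /=; case: ifP.
    set t := #|_|%:R.
    have tmu : mu * n%:R <= t.
      have : #|nbr Phi S|%:R <= #|S|%:R + k%:R * t.
        by rewrite -natrM -natrD ler_nat card_nbr.
      have : sg * n%:R <= eps / 2 * n%:R.
        by rewrite ler_wpM2r ?ler0n// ge_min lexx.
      have kt : k%:R * t <= k.+1%:R * t by rewrite ler_wpM2r ?ler0n// ler_nat.
      move=> h1 h2.
      have h3 : eps / 2 * n%:R <= k.+1%:R * t by lra.
      rewrite /mu invfM mulrA mulrAC ler_pdivrMr ?ltr0n// [leRHS]mulrC.
      by [].
    rewrite -[leLHS]/1 -[leLHS]expR0 ler_expR.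
    have := ler_wpM2l (ltW lam0) tmu.
    have lammu : lam * mu = 2 by rewrite divfK ?gt_eqF.
    by rewrite mulrA lammu; lra.
  rewrite avgZ (avg_tuple_prod (fun _ c => expR (lam * tc c))) prodr_const card_ord.
  have Ec : avg (fun c => expR (lam * tc c)) <= expR (expR lam * k.+1%:R * sg).
    apply: le_trans (_ : 1 + expR lam * (k%:R * sg) <= _); last first.
      apply: le_trans (expR_ge1Dx _) _; rewrite ler_expR -mulrA ler_wpM2l ?expR_ge0//.
      by rewrite ler_wpM2r ?ler_nat// ltW.
    apply: (@le_trans _ _ (avg (fun c : clause k n =>
        1 + expR lam * \sum_s ((tnth c s).1 \in S)%:R))).
      apply: le_avg => c; rewrite /tc; case: existsP => [[s cs]|_] /=.
        rewrite mulr1 (bigD1 s)//= cs mulrDr mulr1.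
        have : 0 <= expR lam * \sum_(i | i != s) ((tnth c i).1 \in S)%:R :> R.
          by rewrite mulr_ge0 ?expR_ge0// sumr_ge0.
        by lra.
      by rewrite mulr0 expR0 lerDl mulr_ge0 ?expR_ge0// sumr_ge0.
    rewrite avgD avg_cst ?clause_gt0// avgZ avg_sum lerD2l ler_wpM2l ?expR_ge0//.
    rewrite (eq_bigr (fun _ : 'I_k => #|S|%:R / n%:R)) => [|s _].
      rewrite sumr_const card_ord -[_ *+ k]mulr_natl ler_wpM2l ?ler0n//.
      by rewrite ler_pdivrMr.
    rewrite (avg_tuple_coord s (fun l : literal n => (l.1 \in S)%:R)) ?literal_gt0//.
    rewrite (avg_pair (fun (i : 'I_n) (_ : bool) => (i \in S)%:R)).
    rewrite (eq_avg (G := fun i : 'I_n => (i \in S)%:R)) => [|i]; last first.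
      by rewrite avg_cst// card_bool.
    rewrite /avg card_ord; congr (_ / _).
    by rewrite -sum1_card natr_sum [RHS]big_mkcond/=; apply: eq_bigr => i _; case: ifP.
  apply: le_trans (ler_wpM2l (expR_ge0 _) _) _.
    apply: (@lerXn2r _ m _ (expR (expR lam * k.+1%:R * sg))) Ec.
      by rewrite nnegrE avg_ge0// => c; exact: expR_ge0.
    by rewrite nnegrE expR_ge0.
  rewrite -expRM_natl -expRD ler_expR.
  have sgq : sg * q <= 1.
    apply: le_trans (ler_wpM2r (ltW q0) (_ : sg <= q^-1)) _.
      by rewrite ge_min lexx orbT.
    by rewrite mulVf// gt_eqF.
  have qsg : alpha * (expR lam * k.+1%:R * sg) <= 1 / 2.
    have : 0 <= expR lam * k.+1%:R * sg.
      by rewrite !mulr_ge0 ?expR_ge0// ltW.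
    have sgqE : sg * q = 2 * (alpha + 1) * (expR lam * k.+1%:R * sg).
      by rewrite /q; ring.
    by move: sgq; rewrite sgqE; set z := expR lam * k.+1%:R * sg; lra.
  rewrite -mulr_natl.
  have z0 : 0 <= expR lam * k.+1%:R * sg by rewrite !mulr_ge0 ?expR_ge0// ltW.
  have := ler_wpM2r z0 mn.
  have := ler_wpM2r (ltW nR0) qsg.
  by lra.
apply: (@le_trans _ _ (\sum_(S : {set 'I_n}) expR (- (3 / 2 * n%:R)))).
  apply: (@le_trans _ _ (\sum_(S : {set 'I_n}) avg (ev S))); last exact: ler_sum.
  rewrite -avg_sum; apply: le_avg => Phi.
  case: existsP => [[S PS]|_] /=; last by rewrite sumr_ge0// => S _; rewrite ler0n.
  by rewrite (bigD1 S)//= /ev PS /= lerDl sumr_ge0// => S' _; rewrite ler0n.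
have cS : #|{: {set 'I_n}}| = (2 ^ n)%N.
  by rewrite -cardsT -powersetT card_powerset cardsT card_ord.
rewrite sumr_const cS -[_ *+ (2 ^ n)%N]mulr_natl natrX.
apply: le_trans (ler_wpM2r (expR_ge0 _) (_ : _ <= expR (n%:R * 1))) _.
  rewrite expRM_natl lerXn2r ?nnegrE ?expR_ge0//.
  by apply: le_trans (expR_ge1Dx 1); rewrite -natr1.
by rewrite -expRD ler_expR; lra.
Qed.

Lemma expansion alpha r : 0 <= alpha -> forall eps, 0 < eps ->
  exists2 sg : R, 0 < sg & forall n m, (0 < n)%N -> m%:R <= alpha * n%:R ->
  avg (fun Phi : formula k n m => [exists S : {set 'I_n},
    (#|S|%:R <= sg * n%:R) && (eps * n%:R < #|iter r (nbr Phi) S|%:R)]%:R : R)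
  <= r%:R * expR (- (n%:R / 2)).
Proof.
move=> alpha0; elim: r => [|r IH] eps eps0.
  exists eps => // n m n0 _; rewrite mul0r; apply: avg_le_cst => // Phi.
  case: existsP => // -[S /andP[/= h1 h2]].
  by have := lt_le_trans h2 h1; rewrite ltxx.
have [sg1 sg10 H1] := IH _ eps0.
have [sg sg0 H2] := expansion_step alpha0 sg10.
exists sg => // n m n0 mn; rewrite -natr1 mulrDl mul1r.
apply: le_trans (lerD (H1 n m n0 mn) (H2 n m n0 mn)).
rewrite -avgD; apply: le_avg => Phi.
case: existsP => [[S /andP[h1 h2]]|_] /=; last by rewrite addr_ge0 ?ler0n.
rewrite -natrD ler1n addn_gt0.
have [h3|h3] := leP #|nbr Phi S|%:R (sg1 * n%:R).
  apply/orP; left; rewrite lt0b; apply/existsP; exists (nbr Phi S).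
  by rewrite h3 -iterSr.
by apply/orP; right; rewrite lt0b; apply/existsP; exists S; rewrite h1.
Qed.

End expansion.

Section prediction.
Context {R : realType} {k n L : nat}.
Implicit Types (y : assignment n) (prev : seq (assignment n)) (v : R).

Let types : finType := {ffun 'I_L -> bool}.
Let predictor : finType := {ffun types -> 'I_k.+1}.

(* Smoothing keeps the weights away from 0, which makes [loss] Lipschitz; its
   price is the factor [k.+2 / k] in [empirical_wt], harmless after taking [k]-th
   powers. *)
Definition wt (a : 'I_k.+1) (b : bool) : R :=
  (if b then a.+1 else (k - a).+1)%:R / k.+2%:R.

Definition typ prev (i : 'I_n) : {ffun 'I_L -> bool} :=
  [ffun j : 'I_L => nth [ffun=> false] prev j i].

Definition pwt (a : predictor) prev y (i : 'I_n) : R := wt (a (typ prev i)) (y i).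

Definition loss (a : predictor) y prev : R := \sum_i - ln (pwt a prev y i).

Definition loss_le v y prev : bool := [exists a : predictor, loss a y prev <= v].

Lemma wt_gt0 a b : 0 < wt a b.
Proof. by rewrite divr_gt0// ltr0n; case: b. Qed.

Lemma pwt_gt0 a prev y i : 0 < pwt a prev y i.
Proof. exact: wt_gt0. Qed.

Lemma wt_ge a b : (k.+2%:R)^-1 <= wt a b.
Proof.
by rewrite -[leLHS]mul1r ler_wpM2r ?invr_ge0 ?ler0n// ler1n; case: b.
Qed.

Lemma wtD a : wt a true + wt a false = 1.
Proof.
rewrite /wt -mulrDl -natrD addSn addnS subnKC ?divff ?pnatr_eq0//.
by rewrite -ltnS.
Qed.

Lemma wt_le1 a b : wt a b <= 1.
Proof.
by rewrite -(wtD a); case: b; rewrite ?lerDl ?lerDr ltW// wt_gt0.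
Qed.

Lemma ln_wt_ge0 a b : 0 <= - ln (wt a b).
Proof. by rewrite oppr_ge0 ln_le0// wt_le1. Qed.

Lemma ln_wt_le a b : - ln (wt a b) <= ln k.+2%:R.
Proof.
rewrite -lnV ?posrE ?wt_gt0// ler_ln ?posrE ?invr_gt0 ?wt_gt0 ?ltr0n//.
by rewrite -[leRHS]invrK lef_pV2 ?posrE ?wt_gt0 ?invr_gt0 ?ltr0n// wt_ge.
Qed.

Lemma sum_exp_loss a prev : \sum_y expR (- loss a y prev) = 1.
Proof.
rewrite (eq_bigr (fun y : assignment n => \prod_i wt (a (typ prev i)) (y i))).
  rewrite -(bigA_distr_bigA (fun i b => wt (a (typ prev i)) b))/=.
  by rewrite big1// => i _; rewrite big_bool /= wtD.
move=> y _; rewrite /loss sumrN opprK -prodr_expR; apply: eq_bigr => i _.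
by rewrite lnK// posrE pwt_gt0.
Qed.

Lemma count_loss_le v prev :
  \sum_y (loss_le v y prev)%:R <= #|predictor|%:R * expR v.
Proof.
apply: (@le_trans _ _ (\sum_y \sum_a expR (v - loss a y prev))).
  apply: ler_sum => y _; rewrite /loss_le; case: existsP => [[a av]|_] /=; last first.
    by rewrite sumr_ge0// => a _; exact: expR_ge0.
  rewrite (bigD1 a)//=; apply: ler_wpDr.
    by rewrite sumr_ge0// => a' _; exact: expR_ge0.
  by rewrite -[leLHS]expR0 ler_expR subr_ge0.
rewrite exchange_big/= (eq_bigr (fun _ => expR v)) => [|a _].
  by rewrite sumr_const mulr_natl.
rewrite (eq_bigr (fun y => expR v * expR (- loss a y prev))) => [|y _].
  by rewrite -mulr_sumr sum_exp_loss mulr1.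
by rewrite -expRD.
Qed.

Lemma loss_le_lipschitz v w y y' prev :
  v + ln k.+2%:R * #|[pred i | y i != y' i]|%:R <= w ->
  loss_le v y prev -> loss_le w y' prev.
Proof.
move=> vw /existsP[a av]; apply/existsP; exists a; apply: le_trans vw.
apply: le_trans (lerD av (lexx _)); rewrite /loss -sum1_card natr_sum mulr_sumr.
rewrite [X in _ <= _ + X]big_mkcond -big_split/=; apply: ler_sum => i _.
rewrite inE /pwt mulr1; case: eqP => [->|_] /=; first by rewrite addr0.
by rewrite ler_wpDl ?ln_wt_ge0// ln_wt_le.
Qed.

Lemma loss_le_mem v y prev : y \in prev -> (size prev <= L)%N ->
  n%:R / k.+1%:R <= v -> loss_le v y prev.
Proof.
move=> yp pL nv; have jL : (index y prev < L)%N by rewrite (leq_trans _ pL)// index_mem.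
apply/existsP; exists [ffun t : types => if t (Ordinal jL) then ord_max else ord0].
apply: le_trans nv.
rewrite /loss (_ : _ / _ = \sum_(i < n) k.+1%:R^-1); last first.
  by rewrite sumr_const card_ord mulr_natl.
apply: ler_sum => i _; rewrite /pwt !ffunE /= nth_index//.
have -> : wt (if y i then ord_max else ord0) (y i) = k.+1%:R / k.+2%:R.
  by rewrite /wt; case: (y i); rewrite //= subn0.
have k1 : (0 : R) < k.+1%:R by rewrite ltr0n.
rewrite -lnV ?posrE ?divr_gt0 ?ltr0n// invf_div.
have -> : k.+2%:R / k.+1%:R = 1 + k.+1%:R^-1 :> R.
  by rewrite -[k.+2%:R]natr1 mulrDl divff ?gt_eqF// mul1r.
by rewrite (le_trans (le_ln1Dx _))// (lt_trans (ltrN10 _))// invr_gt0.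
Qed.

Definition empirical y prev : predictor :=
  [ffun t => inord ((#|[pred i | (typ prev i == t) && y i]| * k) %/
                    #|[pred i | typ prev i == t]|)].

Lemma empirical_wt y prev t b : (0 < k)%N ->
  #|[pred i | (typ prev i == t) && (y i == b)]|%:R / wt (empirical y prev t) b
  <= #|[pred i | typ prev i == t]|%:R * (k.+2%:R / k%:R).
Proof.
move=> k0; set N := #|[pred i | typ prev i == t]|.
set s := #|[pred i | (typ prev i == t) && y i]|.
have sN : (#|[pred i | (typ prev i == t) && ~~ y i]| + s = N)%N.
  rewrite /N /s -(cardID [pred i | ~~ y i] [pred i | typ prev i == t]).
  congr addn; apply: eq_card => i; rewrite !inE //.
  by rewrite andbC negbK.
have aE : empirical y prev t = ((s * k) %/ N)%N :> nat.
  rewrite ffunE inordK// ltnS -/s -/N.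
  have [->|N0] := posnP N; first by rewrite divn0.
  by rewrite -[X in (_ <= X)%N](mulKn k N0) leq_div2r// leq_mul2r -sN leq_addl orbT.
have key : (#|[pred i | (typ prev i == t) && (y i == b)]| * k <=
    N * (if b then (empirical y prev t).+1 else (k - empirical y prev t).+1))%N.
  case: b => /=.
    rewrite (eq_card (B := [pred i | (typ prev i == t) && y i])); last first.
      by move=> i; rewrite !inE eqb_id.
    rewrite -/s; have [N0|N0] := posnP N.
      by have -> : s = 0%N by apply/eqP; rewrite -leqn0 -N0 -sN leq_addl.
    by rewrite aE [leqRHS]mulnC ltnW// ltn_ceil.
  rewrite (eq_card (B := [pred i | (typ prev i == t) && ~~ y i])); last first.
    by move=> i; rewrite !inE eqbF_neg.
  rewrite mulnS mulnBr -leq_subLR.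
  have : (N * empirical y prev t <= s * k)%N by rewrite aE mulnC leq_trunc_div.
  rewrite -[X in (X * k - _)%N](addnK s) sN mulnBl.
  by move: (N * _)%N (s * k)%N (N * k)%N => x z u; lia.
rewrite /wt invf_div mulrA mulrA ler_pdivlMr ?ltr0n// mulrAC.
rewrite ler_pdivrMr ?ltr0n; last by case: (b).
rewrite -!natrM ler_nat mulnAC [X in (_ <= X)%N]mulnAC leq_mul2r key orbT//.
Qed.

Lemma sum_agree_empirical y prev (j : 'I_L) : (0 < k)%N ->
  \sum_i (y i == nth [ffun=> false] prev j i)%:R / pwt (empirical y prev) prev y i
  <= n%:R * (k.+2%:R / k%:R).
Proof.
move=> k0; rewrite (partition_big (typ prev) xpredT)//=.
apply: (@le_trans _ _ (\sum_(t : types)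
   #|[pred i | typ prev i == t]|%:R * (k.+2%:R / k%:R))).
  apply: ler_sum => t _.
  apply: le_trans (empirical_wt y prev t (t j) k0).
  rewrite -sum1_card natr_sum mulr_suml big_mkcond [leRHS]big_mkcond/=.
  apply: ler_sum => i _; rewrite inE; case: eqP => // tE /=.
  have -> : nth [ffun=> false] prev j i = t j by rewrite -tE ffunE.
  by case: eqP => [yi|_]; rewrite ?mul0r// /pwt tE yi.
rewrite -mulr_suml -natr_sum.
rewrite (_ : (\sum_t _)%N = n)// -[RHS](card_ord n) -sum1_card.
rewrite (partition_big (typ prev) xpredT)//=.
by apply: eq_bigr => t _; rewrite sum1_card.
Qed.

End prediction.

Section clause_probability.
Context {R : realType} {k n L : nat}.
Hypotheses (k_gt0 : (0 < k)%N) (n_gt0 : (0 < n)%N).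
Implicit Types (y : assignment n) (prev : seq (assignment n)) (c : clause k n).

Definition unsat y c : R := (~~ clause_sat y c)%:R.

Definition unsat_first y prev c : R :=
  (~~ clause_sat y c && all (fun y' => clause_sat y' c) prev)%:R.

Lemma unsatE y c : unsat y c = \prod_s (y (tnth c s).1 != (tnth c s).2)%:R.
Proof.
rewrite /unsat /clause_sat -natr_prod; congr (_%:R).
have [/hasP[l lc yl]|/hasPn nyc] := boolP (has _ c).
  have [s ls] := tnthP _ _ lc; rewrite (bigD1 s)//= -ls.
  by move: yl; rewrite /literal_sat => /eqP ->; rewrite eqxx.
rewrite big1// => s _; have /nyc := mem_tnth s c.
by rewrite /literal_sat => ->.
Qed.

Lemma avg_literal y (g : 'I_n -> R) :
  avg (fun l : literal n => (y l.1 != l.2)%:R * g l.1) = 2^-1 * avg g.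
Proof.
rewrite (avg_pair (fun i b => (y i != b)%:R * g i)) -avgZ; apply: eq_avg => i.
rewrite /avg card_bool big_bool /=.
by case: (y i); rewrite /= ?mul1r ?mul0r ?addr0 ?add0r mulrC.
Qed.

Lemma avg_unsat_prod y (g : 'I_n -> R) :
  avg (fun c => unsat y c * \prod_s g (tnth c s).1) = 2^-1 ^+ k * avg g ^+ k.
Proof.
rewrite -exprMn -(avg_literal y g) -[k in RHS]card_ord -prodr_const.
rewrite -(avg_tuple_prod (fun (_ : 'I_k) (l : literal n) => (y l.1 != l.2)%:R * g l.1)).
by apply: eq_avg => c; rewrite unsatE -big_split.
Qed.

Lemma avg_unsat y : avg (unsat y) = 2^-1 ^+ k.
Proof.
rewrite -[RHS]mulr1 -[X in _ * X](expr1n _ k).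
rewrite -{2}(avg_cst (T := 'I_n) 1) ?card_ord// -(avg_unsat_prod y).
by apply: eq_avg => c; rewrite big1 ?mulr1.
Qed.

Lemma exp_le_chord (a x B : R) : 0 < B -> 0 <= x -> x <= B ->
  expR (- (a * (x / B))) <= 1 - (1 - expR (- a)) * (x / B).
Proof.
move=> B0 x0 xB; set t := x / B.
have t0 : 0 <= t by rewrite divr_ge0// ltW.
have t1 : t <= 1 by rewrite ler_pdivrMr// mul1r.
have := convex_expR (Itv01 t0 t1) (- a) 0.
rewrite !convRE /= expR0 mulr0 addr0 mulr1 mulrN mulrC => h.
by apply: le_trans h _; rewrite /unstable.onem; lra.
Qed.

(* If a clause is violated by [y] and by an element [y'] of [prev], then [y']
   correctly predicts [y] on the variables of the clause. Either these bits
   carry at most [ln k.+2] of information, or this happens for a given [y'] with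
   probability at most about [1 / k]. *)
Lemma unsat_first_lower_bound (beta : R) y prev : 1 < beta -> (size prev <= L)%N ->
  (forall a : {ffun {ffun 'I_L -> bool} -> 'I_k.+1},
     beta * ln k.+2%:R / k%:R * n%:R <= loss a y prev) ->
  2^-1 ^+ k * (1 - beta * expR (1 - beta) - L%:R / k%:R * expR 2) <=
  avg (unsat_first y prev).
Proof.
move=> beta1 pL hloss.
have beta0 : 0 < beta by lra.
pose a : {ffun {ffun 'I_L -> bool} -> 'I_k.+1} := empirical y prev.
pose w i : R := pwt a prev y i.
have w0 i : 0 < w i by exact: pwt_gt0.
pose B : R := ln k.+2%:R.
have kR0 : (0 : R) < k%:R by rewrite ltr0n.
have nR0 : (0 : R) < n%:R by rewrite ltr0n.
have k2 : (0 : R) < k.+2%:R by rewrite ltr0n.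
have B0 : 0 < B by rewrite ln_gt0// ltr1n.
pose th : R := ln beta / B.
have th0 : 0 < th by rewrite divr_gt0// ln_gt0.
pose W i : R := - ln (w i).
have W0 i : 0 <= W i by exact: ln_wt_ge0.
have WB i : W i <= B by exact: ln_wt_le.
pose Q c : R := \prod_s w (tnth c s).1.
have Q0 c : 0 < Q c by rewrite prodr_gt0.
pose info c : R := beta * \prod_s expR (- (th * W (tnth c s).1)).
pose agree (j : 'I_L) i : R := (y i == nth [ffun=> false] prev j i)%:R / w i.
pose hits (j : 'I_L) c : R := k.+2%:R^-1 * \prod_s agree j (tnth c s).1.
have infoE c : info c = expR (ln beta - th * - ln (Q c)).
  rewrite /info prodr_expR expRD lnK ?posrE//; congr (_ * expR _).
  have -> : ln (Q c) = \sum_s - W (tnth c s).1.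
    rewrite -[RHS]expRK -prodr_expR; congr ln; apply: eq_bigr => s _.
    by rewrite /W opprK lnK// posrE.
  by rewrite sumrN sumrN opprK mulr_sumr.
have agree0 j i : 0 <= agree j i by rewrite divr_ge0 ?ler0n// ltW.
have hits0 j c : 0 <= hits j c by rewrite mulr_ge0 ?invr_ge0 ?ler0n// prodr_ge0.
have pointwise c : unsat y c - unsat y c * info c - \sum_j unsat y c * hits j c
    <= unsat_first y prev c.
  rewrite /unsat_first /unsat; case: (boolP (clause_sat y c)) => /= [_|yc].
    by rewrite !mul0r big1 ?subr0// => j _; rewrite mul0r.
  rewrite !mul1r (eq_bigr (fun j => hits j c)) => [|j _]; last by rewrite mul1r.
  have info0 : 0 <= info c by rewrite infoE expR_ge0.
  have sum0 : 0 <= \sum_j hits j c by rewrite sumr_ge0.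
  have [_|/allPn[y' y'p y'c]] := boolP (all _ prev); first by rewrite -[leRHS]/1; lra.
  suff : 1 <= info c + \sum_j hits j c by move=> h; rewrite -[leRHS]/0; lra.
  have [lnQ|lnQ] := leP (- ln (Q c)) B.
    apply: ler_wpDr => //; rewrite infoE -[leLHS]expR0 ler_expR subr_ge0.
    by apply: le_trans (ler_wpM2l (ltW th0) lnQ) _; rewrite divfK// gt_eqF.
  apply: ler_wpDl => //.
  have jL : (index y' prev < L)%N by rewrite (leq_trans _ pL)// index_mem.
  rewrite (bigD1 (Ordinal jL))//=; apply: ler_wpDr; first by rewrite sumr_ge0.
  rewrite /hits (eq_bigr (fun s => (w (tnth c s).1)^-1)) => [|s _]; last first.
    rewrite /agree /= nth_index//.
    have lsat (z : assignment n) : ~~ clause_sat z c ->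
        z (tnth c s).1 != (tnth c s).2.
      by move/hasPn/(_ _ (mem_tnth s c)).
    move: (lsat _ yc) (lsat _ y'c).
    by case: (y _) (y' _) (tnth c s).2 => [] [] []; rewrite //= mul1r.
  rewrite prodfV -/(Q c) -invfM invf_ge1 ?mulr_gt0// -ler_pdivlMl// mulr1.
  rewrite -ler_ln ?posrE ?invr_gt0// lnV ?posrE//.
  by rewrite lerNr ltW.
apply: le_trans (le_avg pointwise).
rewrite !avgB avg_unsat avg_sum mulrBr mulrBr mulr1 -!addrA lerD2l -opprD -opprD lerN2.
apply: lerD.
  have -> : avg (fun c => unsat y c * info c) =
      beta * (2^-1 ^+ k * avg (fun i => expR (- (th * W i))) ^+ k).
    by rewrite -(avg_unsat_prod y) -avgZ; apply: eq_avg => c; rewrite /info mulrCA.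
  rewrite mulrCA ler_wpM2l ?exprn_ge0 ?invr_ge0//.
  apply: ler_wpM2l; first exact: ltW.
  have : avg (fun i => expR (- (th * W i))) <= expR (- ((beta - 1) / k%:R)).
    apply: (@le_trans _ _ (avg (fun i => 1 - (1 - beta^-1) / B * W i))).
      apply: le_avg => i; have := exp_le_chord (ln beta) B0 (W0 i) (WB i).
      rewrite [expR (- ln beta)]expRN lnK ?posrE//.
      by rewrite mulrA [ln beta * W i / B]mulrAC -/th mulrA [_ * W i / B]mulrAC.
    rewrite avgB avg_cst ?card_ord// avgZ.
    apply: le_trans (expR_ge1Dx _); rewrite lerD2l lerN2.
    have lossE : avg W = loss a y prev / n%:R by rewrite /avg card_ord.
    have b1 : 0 <= (1 - beta^-1) / B.
      by rewrite divr_ge0 ?ltW// subr_gt0 invf_lt1.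
    rewrite lossE.
    apply: (@le_trans _ _ ((1 - beta^-1) / B * (beta * B / k%:R))).
      rewrite le_eqVlt; apply/orP; left; apply/eqP.
      by field; rewrite !gt_eqF.
    rewrite ler_wpM2l// ler_pdivlMr//; exact: hloss.
  move=> h; apply: (@le_trans _ _ (expR (- ((beta - 1) / k%:R)) ^+ k)).
    by rewrite lerXn2r ?nnegrE ?expR_ge0// avg_ge0// => i; exact: expR_ge0.
  rewrite -expRM_natl ler_expR mulrN mulrCA divff ?gt_eqF// mulr1; lra.
apply: (@le_trans _ _ (\sum_(j < L) 2^-1 ^+ k * (k%:R^-1 * expR 2))); last first.
  rewrite sumr_const card_ord -[_ *+ L]mulr_natl.
  by rewrite mulrCA -!mulrA.
apply: ler_sum => j _.
have -> : avg (fun c => unsat y c * hits j c) =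
    k.+2%:R^-1 * (2^-1 ^+ k * avg (agree j) ^+ k).
  by rewrite -(avg_unsat_prod y) -avgZ; apply: eq_avg => c; rewrite /hits mulrCA.
rewrite mulrCA ler_wpM2l ?exprn_ge0 ?invr_ge0//.
apply: ler_pM; rewrite ?invr_ge0 ?ler0n ?exprn_ge0 ?avg_ge0//.
  by rewrite lef_pV2 ?posrE// ler_nat leqW.
have : avg (agree j) <= expR (2 / k%:R).
  rewrite /avg card_ord ler_pdivrMr//.
  apply: le_trans (sum_agree_empirical y prev j k_gt0) _.
  rewrite mulrC ler_wpM2r ?ler0n//.
  apply: le_trans (expR_ge1Dx _).
  by rewrite -[k.+2]addn2 natrD mulrDl divff// gt_eqF.
move=> h; apply: (@le_trans _ _ (expR (2 / k%:R) ^+ k)).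
  by rewrite lerXn2r ?nnegrE ?expR_ge0// avg_ge0.
by rewrite -expRM_natl mulrC divfK// gt_eqF.
Qed.

End clause_probability.

Section first_moment.
Context {R : realType} {k n m K L : nat}.
Hypotheses (k_gt0 : (0 < k)%N) (n_gt0 : (0 < n)%N).
Variables (blk : 'I_m -> 'I_K) (lam nu : R).
Hypothesis lam_ge0 : 0 <= lam.

Let Omega : finType := {ffun 'I_L.+1 -> formula k n m}.
Let choices : finType := {ffun 'I_K -> 'I_L.+1}.
Implicit Types (y : assignment n) (ys prev : seq (assignment n)) (C : clause k n).
Implicit Type h : seq (choices * assignment n).

Let form_gt0 : (0 < #|formula k n m|)%N := formula_gt0 m n_gt0.

Lemma nu_satisfies_le y (Phi : formula k n m) :
  (nu_satisfies nu y Phi)%:R <=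
  expR (lam * (nu * m%:R) - lam * \sum_i unsat y (tnth Phi i)) :> R.
Proof.
have [yPhi|_] := boolP (nu_satisfies nu y Phi); last exact: expR_ge0.
rewrite -[leLHS]/1 -[leLHS]expR0 ler_expR -mulrBr mulr_ge0// subr_ge0.
have -> : \sum_i unsat y (tnth Phi i) = m%:R - (nsat y Phi)%:R :> R.
  apply/eqP; rewrite eq_sym subr_eq -natr_sum -natrD; apply/eqP; congr (_%:R).
  rewrite /nsat -sum1_card [X in (_ + X)%N]big_mkcond -big_split/=.
  rewrite (eq_bigr (fun _ => 1%N)) ?sum1_card ?card_ord// => i _.
  by rewrite inE; case: clause_sat.
by move: yPhi; rewrite /nu_satisfies; lra.
Qed.

(* Splits the event that an assignment selected by [P] violates [C] according to
   the last pair of [h] whose assignment violates [C]. *)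
Fixpoint fresh (P : pred choices) h C : R :=
  if h is p :: h' then
    (P p.1)%:R * unsat_first p.2 (map snd h') C + fresh P h' C
  else 0.

Lemma fresh_le P h C :
  fresh P h C <= (has (fun p => P p.1 && ~~ clause_sat p.2 C) h)%:R.
Proof.
elim: h => //= p h IH; rewrite /unsat_first.
have [allsat|nallsat] := boolP (all _ _); last first.
  rewrite andbF mulr0 add0r (le_trans IH)// ler_nat.
  by case: (_ && _) => //; case: has.
have h0 : has (fun p => P p.1 && ~~ clause_sat p.2 C) h = false.
  apply/negbTE/hasPn => q qh; rewrite negb_and negbK.
  by rewrite (allP allsat) ?orbT// map_f.
rewrite h0 in IH *; rewrite orbF andbT -mulnb natrM.
by have := IH; rewrite -[X in _ <= X -> _]/0; lra.
Qed.

Lemma group_bound P h C :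
  expR (- (lam * \sum_(p <- h | P p.1) unsat p.2 C)) <=
  1 - (1 - expR (- lam)) * fresh P h C.
Proof.
have lam1 : expR (- lam) <= 1 by rewrite -[leRHS]expR0 ler_expR oppr_le0.
have sum0 (h' : seq _) : 0 <= \sum_(p <- h' | P p.1) unsat p.2 C :> R.
  by apply: sumr_ge0 => p _; rewrite ler0n.
have := fresh_le P h C; have [/hasP[p ph /andP[Pp pC]]|_] := boolP (has _ _).
  rewrite -[X in _ <= X -> _]/1 => f1.
  apply: (@le_trans _ _ (expR (- lam))); last first.
    by have := mulr_ge0 (_ : 0 <= 1 - expR (- lam)) (_ : 0 <= 1 - fresh P h C); lra.
  rewrite ler_expR lerN2 -[leLHS]mulr1 ler_wpM2l//.
  have [h1 [h2 ->]] : exists h1, exists h2, h = h1 ++ p :: h2.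
    by case/splitPr: ph => h1 h2; exists h1, h2.
  have up : unsat p.2 C = 1 by rewrite /unsat pC.
  by rewrite big_cat big_cons /= Pp up; have := sum0 h1; have := sum0 h2; lra.
rewrite -[X in _ <= X -> _]/0 => f0.
apply: (@le_trans _ _ 1).
  by rewrite -[leRHS]expR0 ler_expR oppr_le0 mulr_ge0.
by rewrite lerDl oppr_ge0 mulr_ge0_le0// subr_ge0.
Qed.

Fixpoint violation ys : R :=
  if ys is y :: ys' then avg (unsat_first (k := k) y ys') + violation ys' else 0.

Lemma sum_fresh h :
  \sum_(l < L.+1) \sum_(i < m) avg (fresh (fun c => c (blk i) == l) h) =
  m%:R * violation (map snd h).
Proof.
elim: h => [|p h IH] /=.
  rewrite mulr0 big1// => l _; rewrite big1// => i _.
  by rewrite avg_cst// clause_gt0.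
rewrite mulrDr -IH exchange_big [X in _ = _ + X]exchange_big /=.
rewrite -[X in _ = X%:R * _ + _](card_ord m) -sum1_card natr_sum mulr_suml.
rewrite -big_split /=; apply: eq_bigr => i _.
under eq_bigr do rewrite avgD avgZ.
rewrite mul1r big_split /= -mulr_suml (bigD1 (p.1 (blk i)))//= eqxx big1.
  by rewrite addr0 mul1r.
by move=> l; rewrite eq_sym => /negbTE ->.
Qed.

Lemma avg_all_nu_satisfies h :
  avg (fun Psi : Omega =>
    (all (fun p => nu_satisfies nu p.2 (mix blk p.1 Psi)) h)%:R : R) <=
  expR ((size h)%:R * (lam * (nu * m%:R)) -
        (1 - expR (- lam)) * (m%:R * violation (map snd h))).
Proof.
pose G (l : 'I_L.+1) (i : 'I_m) C : R :=
  expR (- (lam * \sum_(p <- h | p.1 (blk i) == l) unsat p.2 C)).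
apply: (@le_trans _ _ (avg (fun Psi : Omega =>
    expR ((size h)%:R * (lam * (nu * m%:R))) *
    \prod_l \prod_i G l i (tnth (Psi l) i)))).
  apply: le_avg => Psi.
  have -> : (all (fun p => nu_satisfies nu p.2 (mix blk p.1 Psi)) h)%:R =
      \prod_(p <- h) (nu_satisfies nu p.2 (mix blk p.1 Psi))%:R :> R.
    by rewrite -big_all -natr_prod; congr (_%:R); elim: h {G} => [|p h IH];
      rewrite ?(big_nil, big_cons)// -IH mulnb.
  apply: (@le_trans _ _ (\prod_(p <- h) expR (lam * (nu * m%:R) -
      lam * \sum_i unsat p.2 (tnth (mix blk p.1 Psi) i)))).
    by apply: ler_prod => p _; rewrite ler0n nu_satisfies_le.
  rewrite -(big_morph _ (@expRD R) (@expR0 R)) big_split /= expRD.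
  rewrite big_const_seq count_predT iter_addr addr0 -[_ *+ size h]mulr_natl.
  rewrite ler_wpM2l ?expR_ge0//.
  under [X in _ <= X]eq_bigr do rewrite prodr_expR.
  rewrite prodr_expR ler_expR le_eqVlt; apply/orP; left; apply/eqP.
  under [RHS]eq_bigr do rewrite sumrN -mulr_sumr.
  rewrite !sumrN -!mulr_sumr; congr (- (_ * _)).
  rewrite exchange_big [RHS]exchange_big /=; apply: eq_bigr => i _.
  under [RHS]eq_bigr do rewrite big_mkcond.
  rewrite [RHS]exchange_big /=; apply: eq_bigr => p _.
  rewrite (bigD1 (p.1 (blk i)))//= eqxx big1 ?addr0 ?tnth_mktuple//.
  by move=> l; rewrite eq_sym => /negbTE ->.
rewrite avgZ expRD ler_wpM2l ?expR_ge0//.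
rewrite (avg_ffun_prod (fun l (Phi : formula k n m) => \prod_i G l i (tnth Phi i))).
under eq_bigr do rewrite (avg_tuple_prod (fun i C => G _ i C)).
rewrite -sum_fresh mulr_sumr -sumrN -prodr_expR; apply: ler_prod => l _.
have G0 i : 0 <= avg (G l i) by apply: avg_ge0 => C; exact: expR_ge0.
rewrite prodr_ge0//= mulr_sumr -sumrN -prodr_expR; apply: ler_prod => i _.
rewrite G0 /=.
apply: le_trans (le_avg (group_bound (fun c => c (blk i) == l) h)) _.
rewrite avgB avgZ avg_cst ?clause_gt0//.
exact: expR_ge1Dx.
Qed.

Local Notation loss_le v y prev := (@loss_le R k n L v y prev).
Local Notation npred := (#|{ffun {ffun 'I_L -> bool} -> 'I_k.+1}|%:R : R).

Lemma violation_ge0 ys : 0 <= violation ys.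
Proof.
by elim: ys => //= y ys IH; rewrite addr_ge0// avg_ge0// => C; rewrite ler0n.
Qed.

Lemma independent_first_moment (v : R) (Y : formula k n m -> assignment n)
    (c0 : choices) (cs : seq choices) :
  (forall c, c \in cs -> forall b, c b != c0 b) ->
  avg (fun Psi : Omega => [exists y, loss_le v y [seq Y (mix blk c Psi) | c <- cs] &&
    nu_satisfies nu y (mix blk c0 Psi)]%:R : R) <=
  npred * expR v * expR (lam * (nu * m%:R) - (1 - expR (- lam)) * (m%:R * 2^-1 ^+ k)).
Proof.
move=> csP; pose M (l : 'I_L.+1) (i : 'I_m) := l == c0 (blk i).
rewrite -(avg_merge form_gt0 M).
apply: avg_le_cst => [|Psi].
  by rewrite !mulr_ge0 ?expR_ge0.
pose prev := [seq Y (mix blk c Psi) | c <- cs].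
apply: (@le_trans _ _ (avg (fun Z : Omega => \sum_y
    (loss_le v y prev)%:R * (nu_satisfies nu y (mix blk c0 Z))%:R))).
  apply: le_avg => Z.
  have -> : mix blk c0 (merge_copies M Psi Z) = mix blk c0 Z.
    by apply: eq_from_tnth => i; rewrite !(ffunE, tnth_mktuple) /M eqxx.
  have -> : [seq Y (mix blk c (merge_copies M Psi Z)) | c <- cs] = prev.
    apply/eq_in_map => c /csP cc0; congr Y; apply: eq_from_tnth => i.
    by rewrite !(ffunE, tnth_mktuple) /M (negbTE (cc0 _)).
  case: existsP => [[y /andP[yv ysat]]|_] /=; last first.
    by rewrite sumr_ge0// => y _; rewrite mulr_ge0 ?ler0n.
  rewrite (bigD1 y)//= yv ysat mulr1; apply: ler_wpDr => //.
  by rewrite sumr_ge0// => y' _; rewrite mulr_ge0 ?ler0n.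
rewrite avg_sum; apply: le_trans (ler_wpM2r (expR_ge0 _) (count_loss_le v prev)).
rewrite mulr_suml; apply: ler_sum => y _; rewrite avgZ ler_wpM2l ?ler0n//.
have := avg_all_nu_satisfies [:: (c0, y)]; rewrite /= addr0 mul1r.
rewrite (eq_avg (G := fun Psi : Omega => (nu_satisfies nu y (mix blk c0 Psi))%:R)).
  move/le_trans; apply; rewrite ler_expR lerD2l lerN2.
  rewrite ler_wpM2l ?subr_ge0 ?expR_le1 ?oppr_le0//.
  rewrite ler_wpM2l// -(avg_unsat n_gt0 y) le_avg// => C.
  by rewrite /unsat_first andbT.
by move=> Z; rewrite andbT.
Qed.

Section ladder.
Variables (beta vm vp : R).
Hypotheses (beta_gt1 : 1 < beta) (vmE : vm = beta * ln k.+2%:R / k%:R * n%:R).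

Fixpoint ladder ys : bool :=
  if ys is y :: ys' then
    (nilp ys' || loss_le vp y ys' && ~~ loss_le vm y ys') && ladder ys'
  else true.

Let rung : R := 2^-1 ^+ k * (1 - beta * expR (1 - beta) - L%:R / k%:R * expR 2).

Lemma violation_ladder l ys : (size ys = l.+1)%N -> (l <= L)%N -> ladder ys ->
  l%:R * rung <= violation ys.
Proof.
elim: l ys => [|l IH] [|y ys] //= [sys] lL.
  by rewrite mul0r (violation_ge0 (y :: ys)).
case/andP=> + lad; rewrite /nilp sys /= => /andP[_ yvm].
rewrite -natr1 mulrDl mul1r addrC lerD//; last by apply: IH => //; exact: ltnW.
apply: (unsat_first_lower_bound k_gt0 n_gt0 beta_gt1 (L := L)); first by rewrite sys.
move=> a; rewrite -vmE; move: yvm; rewrite negb_exists => /forallP/(_ a).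
by rewrite -ltNge => /ltW.
Qed.

Lemma big_tuple_cons l (T : finType) (F : l.+1.-tuple T -> R) :
  \sum_t F t = \sum_x \sum_(t : l.-tuple T) F (cons_tuple x t).
Proof.
rewrite pair_bigA /= (reindex (fun p : T * l.-tuple T => cons_tuple p.1 p.2))//.
apply: onW_bij; exists (fun t => (thead t, behead_tuple t)).
  by case=> x t; congr pair; apply: val_inj.
by case/tupleP=> x t; apply: val_inj.
Qed.

Lemma count_ladder l :
  \sum_(ys : l.+1.-tuple (assignment n)) (ladder ys)%:R <=
  2 ^+ n * (npred * expR vp) ^+ l.
Proof.
elim: l => [|l IH].
  rewrite big_tuple_cons expr0 mulr1.
  apply: (@le_trans _ _ (\sum_(y : assignment n) 1)).
    apply: ler_sum => y _; rewrite (big_pred1 [tuple])//.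
    by move=> t; apply/esym/eqP; exact: tuple0.
  by rewrite sumr_const card_ffun card_bool card_ord natrX.
rewrite big_tuple_cons exchange_big /=.
apply: (@le_trans _ _ (\sum_(ys : l.+1.-tuple (assignment n))
    (ladder ys)%:R * (npred * expR vp))); last first.
  rewrite -mulr_suml exprSr [leRHS]mulrA ler_wpM2r// mulr_ge0 ?expR_ge0//.
apply: ler_sum => ys _.
case: (ladder ys); last by rewrite big1 ?mul0r// => y _; rewrite andbF.
rewrite mul1r; apply: le_trans (count_loss_le vp ys); apply: ler_sum => y _.
by rewrite andbT ler_nat /nilp size_tuple /=; case: (loss_le _ _ _) => //; case: (~~ _).
Qed.

Lemma ladder_first_moment (T : nat) (ct : 'I_T -> choices) :
  avg (fun Psi : Omega => [exists ts : L.+1.-tuple 'I_T,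
    [exists ys : L.+1.-tuple (assignment n), ladder ys &&
      all (fun p => nu_satisfies nu p.2 (mix blk (ct p.1) Psi)) (zip ts ys)]]%:R : R) <=
  T%:R ^+ L.+1 * (2 ^+ n * (npred * expR vp) ^+ L *
    expR (L.+1%:R * (lam * (nu * m%:R)) -
      (1 - expR (- lam)) * (m%:R * (L%:R * rung)))).
Proof.
pose ev (ts : L.+1.-tuple 'I_T) (ys : L.+1.-tuple (assignment n)) (Psi : Omega) :=
  all (fun p => nu_satisfies nu p.2 (mix blk (ct p.1) Psi)) (zip ts ys).
apply: (@le_trans _ _ (avg (fun Psi : Omega =>
    \sum_(ts : L.+1.-tuple 'I_T) \sum_(ys : L.+1.-tuple (assignment n))
    (ladder ys)%:R * (ev ts ys Psi)%:R : R))).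
  apply: le_avg => Psi.
  have pos (ts : L.+1.-tuple 'I_T) (ys : L.+1.-tuple (assignment n)) :
      0 <= (ladder ys)%:R * (ev ts ys Psi)%:R :> R by rewrite mulr_ge0.
  case: existsP => [[ts /existsP[ys /andP[lad sat]]]|_] /=; last first.
    by rewrite sumr_ge0// => ts _; rewrite sumr_ge0.
  rewrite (bigD1 ts)//= (bigD1 ys)//= lad /ev sat mulr1 -addrA; apply: ler_wpDr => //.
  by rewrite addr_ge0 ?sumr_ge0// => ts' _; rewrite sumr_ge0.
rewrite avg_sum -natrX.
have -> : (T ^ L.+1 = #|{: L.+1.-tuple 'I_T}|)%N by rewrite card_tuple card_ord.
rewrite -sum1_card natr_sum mulr_suml; apply: ler_sum => ts _; rewrite mul1r avg_sum.
apply: le_trans (ler_wpM2r (expR_ge0 _) (count_ladder L)).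
rewrite mulr_suml; apply: ler_sum => ys _; rewrite avgZ.
case: (boolP (ladder ys)) => lad; last by rewrite !mul0r.
rewrite !mul1r.
have := avg_all_nu_satisfies (zip (map ct ts) ys).
have e2 : map snd (zip (map ct ts) ys) = ys.
  by rewrite -[RHS]/(tval ys) [LHS]unzip2_zip// size_map !size_tuple.
rewrite e2 size_zip size_map !size_tuple minnn.
rewrite (eq_avg (G := fun Psi : Omega => (ev ts ys Psi)%:R)) => [|Psi].
  move/le_trans; apply; rewrite ler_expR lerD2l lerN2.
  rewrite ler_wpM2l ?subr_ge0 ?expR_le1 ?oppr_le0//.
  by rewrite ler_wpM2l// violation_ladder// size_tuple.
congr (_%:R); rewrite /ev; congr nat_of_bool.
by elim: (tval ts) (tval ys) => [|t ts' IH] [|y ys'] //=; rewrite IH.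
Qed.

End ladder.

End first_moment.

Section path.
Context {R : realType} {k n m K L : nat}.

Definition block (i : 'I_m) : 'I_K.+1 := inord (i %% K.+1).

(* At time [q * K.+1 + s], the blocks before [s] use the copy number [q.+1] and
   the others use the copy number [q]. *)
Definition path_copy (t : nat) : {ffun 'I_K.+1 -> 'I_L.+1} :=
  [ffun b : 'I_K.+1 => inord ((t + (K - b)) %/ K.+1)].

Definition inst (Psi : {ffun 'I_L.+1 -> formula k n m}) (t : nat) : formula k n m :=
  mix block (path_copy t) Psi.

Lemma path_copy_indep t0 t (b : 'I_K.+1) : (t <= t0)%N -> (t0 + K.+1 <= L * K.+1)%N ->
  path_copy t b != path_copy (t0 + K.+1) b.
Proof.
move=> tt0 t0L; apply/eqP => /(congr1 val); rewrite !ffunE /=.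
have le_t : ((t + (K - b)) %/ K.+1 <= (t0 + (K - b)) %/ K.+1)%N.
  by rewrite leq_div2r// leq_add2r.
have e : ((t0 + K.+1 + (K - b)) %/ K.+1 = ((t0 + (K - b)) %/ K.+1).+1)%N.
  by rewrite addnAC divnDr ?dvdnn// divnn addn1.
have le_L : ((t0 + (K - b)) %/ K.+1 < L)%N.
  rewrite ltn_divLR//; move: t0L; move: (L * K.+1)%N => x.
  by have := leq_subr b K; lia.
rewrite e !inordK ?ltnS//; first by move=> eq; move: le_t; rewrite eq ltnn.
by rewrite (leq_trans le_t)// ltnW.
Qed.

Lemma path_copy_step t (b : 'I_K.+1) : (b != t %% K.+1 :> nat)%N ->
  path_copy t.+1 b = path_copy t b.
Proof.
move=> bt; rewrite !ffunE addSn divnS//.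
suff /negbTE -> : ~~ (K.+1 %| (t + (K - b)).+1)%N by [].
apply: contra bt => /dvdnP[q qE].
have bK : (b <= K)%N by rewrite -ltnS.
have e : (t + K.+1 = q * K.+1 + b)%N by lia.
by rewrite -(modnDr t) e modnMDl modn_small ?ltnS.
Qed.

Lemma inst_step Psi t (i : 'I_m) : (i %% K.+1 != t %% K.+1)%N ->
  tnth (inst Psi t) i = tnth (inst Psi t.+1) i.
Proof.
move=> it; rewrite /inst /mix !tnth_mktuple path_copy_step//.
by rewrite inordK// ltn_pmod.
Qed.

Lemma card_block t : (#|[pred i : 'I_m | i %% K.+1 == t %% K.+1]| <= (m %/ K.+1).+1)%N.
Proof.
pose f (i : 'I_m) : 'I_(m %/ K.+1).+1 := inord (i %/ K.+1).
have fE (i : 'I_m) : f i = (i %/ K.+1)%N :> nat.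
  by rewrite inordK// ltnS leq_div2r// ltnW.
rewrite -[leqRHS]card_ord; apply: (@leq_card_in _ _ f).
move=> i j; rewrite !inE => /eqP it /eqP jt /(congr1 val) /=; rewrite !fE => ij.
by apply: val_inj; rewrite /= (divn_eq i K.+1) ij it -jt -divn_eq.
Qed.

Section deterministic.
Variables (A Y : formula k n m -> assignment n) (eta nu eps vm vp : R).
Hypothesis n_gt0 : (0 < n)%N.
Hypothesis YP : forall Phi, eta_nu_satisfies eta nu (A Phi) Phi ->
  (hamming (A Phi) (Y Phi) <= eta) && nu_satisfies nu (Y Phi) Phi.
Hypothesis vm_ge : n%:R / k.+1%:R <= vm.
Hypothesis vm_le_vp : vm <= vp.
Hypothesis vmp : vm + ln k.+2%:R * ((2 * eta + eps) * n%:R) <= vp.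

Local Notation loss_le v y prev := (@loss_le R k n L v y prev).

Lemma card_neq_trans (x y z : assignment n) :
  (#|[pred i | x i != z i]| <=
   #|[pred i | x i != y i]| + #|[pred i | y i != z i]|)%N.
Proof.
rewrite -!sum1_card !(big_mkcond (fun i => i \in _)) -big_split/=.
by apply: leq_sum => i _; rewrite !inE; case: (x i) (y i) (z i) => [] [] [].
Qed.

Lemma ladder_exists Psi :
  (forall t, (t <= L * K.+1)%N ->
     eta_nu_satisfies eta nu (A (inst Psi t)) (inst Psi t)) ->
  (forall t, (t < L * K.+1)%N ->
     #|[pred i | A (inst Psi t) i != A (inst Psi t.+1) i]|%:R <= eps * n%:R) ->
  (forall t0 s, (t0 + K.+1 <= L * K.+1)%N -> (size s <= L)%N ->
     all (fun t => t <= t0)%N s ->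
     ~~ [exists y, loss_le vp y [seq Y (inst Psi t) | t <- s] &&
                   nu_satisfies nu y (inst Psi (t0 + K.+1))]) ->
  [exists ts : L.+1.-tuple 'I_(L * K.+1).+1,
    [exists ys : L.+1.-tuple (assignment n), @ladder R k n L vm vp ys &&
      all (fun p => nu_satisfies nu p.2 (inst Psi (val p.1))) (zip ts ys)]].
Proof.
move=> succ cont chaos.
have vmvp y prev : loss_le vm y prev -> loss_le vp y prev.
  apply: loss_le_lipschitz; rewrite (eq_card0 (A := [pred i | y i != y i])).
    by rewrite mulr0 addr0.
  by move=> i; rewrite inE eqxx.
pose Ys t := Y (inst Psi t).
have step_lip t : (t < L * K.+1)%N -> forall prev,
    loss_le vm (Ys t) prev -> loss_le vp (Ys t.+1) prev.
  move=> tL prev; apply: loss_le_lipschitz; apply: le_trans vmp; rewrite lerD2l.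
  rewrite ler_wpM2l ?ln_ge0 ?ler1n//.
  have nR0 : (0 : R) < n%:R by rewrite ltr0n.
  have hY t' : (t' <= L * K.+1)%N ->
      #|[pred i | A (inst Psi t') i != Ys t' i]|%:R <= eta * n%:R :> R.
    by move=> /succ/YP/andP[+ _]; rewrite /hamming ler_pdivrMr.
  have hc := cont _ tL; have h1 := hY _ (ltnW tL); have h2 := hY _ tL.
  have := card_neq_trans (Ys t) (A (inst Psi t)) (Ys t.+1).
  have := card_neq_trans (A (inst Psi t)) (A (inst Psi t.+1)) (Ys t.+1).
  have -> : #|[pred i | Ys t i != A (inst Psi t) i]| =
      #|[pred i | A (inst Psi t) i != Ys t i]|.
    by apply: eq_card => i; rewrite !inE eq_sym.
  rewrite -!(ler_nat R) !natrD; lra.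
have main l : (l <= L)%N -> exists t s, [/\ size s = l, (t <= l * K.+1)%N,
    all (fun t' => t' <= t)%N s & @ladder R k n L vm vp (map Ys (t :: s))].
  elim: l => [_|l IH lL]; first by exists 0%N, [::]; split.
  have [t [s [sl tl ts lad]]] := IH (ltnW lL).
  set prev := map Ys (t :: s) in lad.
  have prevL : (size prev <= L)%N by rewrite size_map /= sl.
  have tK : (t + K.+1 <= L * K.+1)%N.
    by rewrite (leq_trans (leq_add tl (leqnn _)))// addnC -mulSn leq_mul2r lL orbT.
  have PK : ~~ loss_le vm (Ys (t + K.+1)%N) prev.
    have := chaos t (t :: s) tK; rewrite /= sl leqnn ts => /(_ lL isT).
    rewrite negb_exists => /forallP/(_ (Ys (t + K.+1)%N)).
    have /andP[_ ->] := YP (succ _ tK).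
    by rewrite andbT; apply: contra; exact: vmvp.
  have exP : exists j, ~~ loss_le vm (Ys (t + j)%N) prev by exists K.+1.
  have [j Pj jmin] := ex_minnP exP.
  have jK : (j <= K.+1)%N by exact: jmin.
  case: j Pj jmin jK => [|j] Pj jmin jK.
    move: Pj; rewrite addn0 => /negP; case.
    by apply: loss_le_mem => //; rewrite mem_head.
  exists (t + j.+1)%N, (t :: s); split.
  - by rewrite /= sl.
  - by rewrite mulSn addnC leq_add.
  - rewrite /= leq_addr /=; apply: sub_all ts => t' /leq_trans; apply.
    exact: leq_addr.
  - rewrite -[ladder _ _ _]/((false || loss_le vp (Ys (t + j.+1)%N) prev &&
      ~~ loss_le vm (Ys (t + j.+1)%N) prev) && @ladder R k n L vm vp prev).
    rewrite Pj lad !andbT /=.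
    rewrite addnS; apply: step_lip.
      by rewrite (leq_trans _ tK)// -addnS leq_add2l.
    have [//|/jmin] := boolP (loss_le vm (Ys (t + j)%N) prev).
    by rewrite ltnn.
have [t [s [sL tL ts lad]]] := main L (leqnn L).
pose idx t' : 'I_(L * K.+1).+1 := inord t'.
have szt : size (map idx (t :: s)) == L.+1 by rewrite size_map /= sL.
have szy : size (map Ys (t :: s)) == L.+1 by rewrite size_map /= sL.
apply/existsP; exists (Tuple szt); apply/existsP; exists (Tuple szy).
rewrite lad /=.
have sat t' : (t' <= L * K.+1)%N -> nu_satisfies nu (Ys t') (inst Psi (idx t')).
  by move=> t'L; rewrite inordK//; have /andP[] := YP (succ _ t'L).
rewrite sat//=; elim: s ts {sL lad szt szy} => //= t' s IH /andP[t't /IH ->].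
by rewrite sat// (leq_trans t't).
Qed.

End deterministic.

Section continuity.
Variables (r : nat) (A : formula k n m -> assignment n).
Hypothesis A_local : forall (Phi Phi' : formula k n m) (ch : pred 'I_m)
    (S0 : {set 'I_n}) i,
  (forall j, ~~ ch j -> tnth Phi j = tnth Phi' j) ->
  (forall j s, ch j -> clause_var Phi (j, s) \in S0) ->
  (forall j s, ch j -> clause_var Phi' (j, s) \in S0) ->
  i \notin iter r (nbr Phi) S0 -> i \notin iter r (nbr Phi') S0 ->
  A Phi i = A Phi' i.

Lemma path_continuity (sg eps : R) Psi t :
  (2 * k * (m %/ K.+1).+1)%:R <= sg * n%:R ->
  (forall t', (t' <= t.+1)%N -> ~~ [exists S : {set 'I_n}, (#|S|%:R <= sg * n%:R) &&
     (eps / 2 * n%:R < #|iter r (nbr (inst Psi t')) S|%:R)]) ->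
  #|[pred i | A (inst Psi t) i != A (inst Psi t.+1) i]|%:R <= eps * n%:R.
Proof.
move=> Ksg exp.
pose ch (i : 'I_m) := (i %% K.+1 == t %% K.+1)%N.
pose E := finset.setX [set j | ch j]%SET [set: 'I_k]%SET.
pose V t' : {set 'I_n} := [set clause_var (inst Psi t') e | e in E]%SET.
pose S0 : {set 'I_n} := (V t :|: V t.+1)%SET.
have inV t' j s : ch j -> clause_var (inst Psi t') (j, s) \in V t'.
  by move=> chj; apply: imset_f; rewrite finset.in_setX !finset.in_set chj.
have cardV t' : (#|V t'| <= k * (m %/ K.+1).+1)%N.
  apply: leq_trans (leq_imset_card _ _) _.
  rewrite cardsX cardsT card_ord mulnC leq_mul2l; apply/orP; right.
  apply: leq_trans (card_block t); apply: eq_leq; apply: eq_card => i.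
  by rewrite finset.in_set inE.
have cardS0 : #|S0|%:R <= sg * n%:R.
  apply: le_trans Ksg; rewrite ler_nat (leq_trans (leq_card_setU _ _))//.
  by rewrite -mulnA mul2n -addnn leq_add.
have bnd t' : (t' <= t.+1)%N -> #|iter r (nbr (inst Psi t')) S0|%:R <= eps / 2 * n%:R.
  move/exp; rewrite negb_exists => /forallP/(_ S0).
  by rewrite cardS0 /= -leNgt.
have : (#|[pred i | A (inst Psi t) i != A (inst Psi t.+1) i]| <=
    #|iter r (nbr (inst Psi t)) S0| + #|iter r (nbr (inst Psi t.+1)) S0|)%N.
  apply: leq_trans (leq_card_setU _ _); apply: subset_leq_card.
  apply/fintype.subsetP => i; rewrite inE; apply: contraR.
  rewrite finset.in_setU negb_or => /andP[i1 i2]; apply/eqP.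
  apply: (A_local (ch := ch) _ _ _ i1 i2).
  - exact: inst_step.
  - by move=> j s chj; rewrite finset.in_setU inV.
  - by move=> j s chj; rewrite finset.in_setU inV ?orbT.
rewrite -(ler_nat R) natrD; have := bnd t (leqnSn t); have := bnd t.+1 (leqnn _); lra.
Qed.

End continuity.

End path.

Section success_bound.
Context {R : realType} {k n m K L r : nat}.
Hypotheses (k_gt0 : (0 < k)%N) (n_gt0 : (0 < n)%N).
Variables (A : formula k n m -> assignment n) (eta nu eps sg lam beta vm vp B3 : R).

Local Notation T := (L * K.+1).+1.
Local Notation histories := {: 'I_T * {l : 'I_L.+1 & l.-tuple 'I_T}}.
Local Notation npred := (#|{ffun {ffun 'I_L -> bool} -> 'I_k.+1}|%:R : R).

Lemma success_bound :
  0 <= lam -> 1 < beta ->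
  vm = beta * ln k.+2%:R / k%:R * n%:R ->
  n%:R / k.+1%:R <= vm -> vm <= vp ->
  vm + ln k.+2%:R * ((2 * eta + eps) * n%:R) <= vp ->
  (2 * k * (m %/ K.+1).+1)%:R <= sg * n%:R ->
  (forall (Phi Phi' : formula k n m) (ch : pred 'I_m) (S0 : {set 'I_n}) i,
    (forall j, ~~ ch j -> tnth Phi j = tnth Phi' j) ->
    (forall j s, ch j -> clause_var Phi (j, s) \in S0) ->
    (forall j s, ch j -> clause_var Phi' (j, s) \in S0) ->
    i \notin iter r (nbr Phi) S0 -> i \notin iter r (nbr Phi') S0 ->
    A Phi i = A Phi' i) ->
  avg (fun Phi : formula k n m => [exists S : {set 'I_n},
    (#|S|%:R <= sg * n%:R) &&
    (eps / 2 * n%:R < #|iter r (nbr Phi) S|%:R)]%:R : R) <= B3 ->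
  avg (fun Phi => (eta_nu_satisfies eta nu (A Phi) Phi)%:R : R) ^+ (L.+1 ^ K.+1) <=
  #|histories|%:R * (npred * expR vp *
     expR (lam * (nu * m%:R) - (1 - expR (- lam)) * (m%:R * 2^-1 ^+ k))) +
  T%:R ^+ L.+1 * (2 ^+ n * (npred * expR vp) ^+ L *
    expR (L.+1%:R * (lam * (nu * m%:R)) - (1 - expR (- lam)) *
      (m%:R * (L%:R * (2^-1 ^+ k *
        (1 - beta * expR (1 - beta) - L%:R / k%:R * expR 2)))))) +
  T%:R * B3.
Proof.
move=> lam0 beta1 vmE vm_ge vmvp vmp Ksg A_local B3P.
have form0 := formula_gt0 (k := k) m n_gt0.
pose Y Phi := odflt (A Phi)
  [pick y | (hamming (A Phi) y <= eta) && nu_satisfies nu y Phi].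
have YP Phi : eta_nu_satisfies eta nu (A Phi) Phi ->
    (hamming (A Phi) (Y Phi) <= eta) && nu_satisfies nu (Y Phi) Phi.
  move=> /existsP[y yP]; rewrite /Y; case: pickP => //= /(_ y).
  by rewrite yP.
pose cs (d : histories) : seq {ffun 'I_K.+1 -> 'I_L.+1} :=
  [seq path_copy (val t) | t <- tagged d.2].
pose okh (d : histories) : bool :=
  (d.1 + K.+1 <= L * K.+1)%N && all (fun t : 'I_T => t <= d.1)%N (tagged d.2).
pose bad1 (d : histories) (Psi : {ffun 'I_L.+1 -> formula k n m}) :=
  okh d && [exists y, @loss_le R k n L vp y
      [seq Y (mix block c Psi) | c <- cs d] &&
    nu_satisfies nu y (mix block (@path_copy K L (d.1 + K.+1)) Psi)].
pose bad2 (Psi : {ffun 'I_L.+1 -> formula k n m}) :=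
  [exists ts : L.+1.-tuple 'I_T, [exists ys : L.+1.-tuple (assignment n),
    @ladder R k n L vm vp ys &&
    all (fun p => nu_satisfies nu p.2 (mix block (@path_copy K L (val p.1)) Psi))
      (zip ts ys)]].
pose bad3 (t : 'I_T) (Psi : {ffun 'I_L.+1 -> formula k n m}) :=
  [exists S : {set 'I_n}, (#|S|%:R <= sg * n%:R) &&
    (eps / 2 * n%:R < #|iter r (nbr (mix block (@path_copy K L t) Psi)) S|%:R)].
apply: le_trans (all_mix_lower_bound form0 (block (K := K)) _) _.
apply: (@le_trans _ _ (avg (fun Psi : {ffun 'I_L.+1 -> formula k n m} =>
    \sum_(d : histories) (bad1 d Psi)%:R + (bad2 Psi)%:R +
    \sum_(t : 'I_T) (bad3 t Psi)%:R : R))).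
  apply: le_avg => Psi.
  have s1 : 0 <= \sum_(d : histories) (bad1 d Psi)%:R :> R by rewrite sumr_ge0.
  have s3 : 0 <= \sum_(t : 'I_T) (bad3 t Psi)%:R :> R by rewrite sumr_ge0.
  have s2 : 0 <= (bad2 Psi)%:R :> R by rewrite ler0n.
  case: (boolP [forall c, _]) => [/forallP all_mix|_]; last by rewrite !addr_ge0.
  have [/existsP[d b1]|/existsPn nb1] := boolP [exists d, bad1 d Psi].
    rewrite (bigD1 d)//= b1 -!addrA lerDl !addr_ge0// sumr_ge0//.
  have [/existsP[t b3]|/existsPn nb3] := boolP [exists t, bad3 t Psi].
    rewrite (bigD1 t)//= b3 addrCA lerDl !addr_ge0// sumr_ge0//.
  suff -> : bad2 Psi by rewrite -addrA addrCA lerDl addr_ge0.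
  apply: (@ladder_exists R k n m K L A Y eta nu eps vm vp) => //.
  - by move=> t tL; exact: all_mix.
  - move=> t tL.
    apply: (path_continuity (r := r) (A := A) _ Ksg) => [|t' t't].
      exact: A_local.
    have t'T : (t' < T)%N by rewrite ltnS (leq_trans t't).
    exact: (nb3 (Ordinal t'T)).
  - move=> t0 s t0L sL st0.
    have t0T : (t0 < T)%N by rewrite ltnS (leq_trans _ t0L)// leq_addr.
    have szs : (size s < L.+1)%N by [].
    pose us : (Ordinal szs).-tuple 'I_T := [tuple of map inord (in_tuple s)].
    pose d : histories := (Ordinal t0T, Tagged (fun l : 'I_L.+1 => l.-tuple 'I_T) us).
    have valK t : t \in s -> val (inord t : 'I_T) = t.
      by move=> ts; rewrite /= inordK// (leq_trans _ t0T)// ltnS (allP st0).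
    have := nb1 d; rewrite /bad1 /okh t0L /=.
    have -> /= : all (fun t : 'I_T => t <= t0)%N (map inord s).
      by apply/allP => _ /mapP[t ts ->]; rewrite [nat_of_ord _]valK// (allP st0).
    rewrite /cs /= -!map_comp.
    rewrite (_ : map _ s = [seq Y (@inst k n m K L Psi t) | t <- s])//.
    by apply/eq_in_map => t ts /=; rewrite [nat_of_ord _]valK.
rewrite !avgD; apply: lerD; first apply: lerD.
- rewrite avg_sum -sum1_card natr_sum mulr_suml; apply: ler_sum => d _.
  rewrite mul1r /bad1; case: (boolP (okh d)) => [/andP[d1 d2]|_] /=; last first.
    by rewrite avg_le_cst// ?mulr_ge0 ?expR_ge0.
  apply: independent_first_moment => // c /mapP[t td ->] b.
  by apply: path_copy_indep d1; exact: (allP d2).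
- have := ladder_first_moment k_gt0 n_gt0 (block (K := K)) nu lam0 vp beta1 vmE
    (fun t : 'I_T => @path_copy K L t).
  exact.
- rewrite avg_sum -[X in X%:R * B3](card_ord T) -sum1_card natr_sum mulr_suml.
  apply: ler_sum => t _; rewrite mul1r; apply: le_trans B3P.
  by rewrite -(avg_mix form0 (block (K := K)) (@path_copy K L t)).
Qed.

End success_bound.

Section measure_average.
Local Open Scope classical_set_scope.
Local Open Scope ereal_scope.

Lemma average_measure_le (R : realType) (d : measure_display) (T : measurableType d)
    (mu : probability T R) (I : finType) (A : I -> set T) (B : R) :
  (forall i, measurable (A i)) -> (forall x, avg (fun i => \1_(A i) x : R) <= B)%R ->
  \sum_i (#|I|%:R^-1)%:E * mu (A i) <= B%:E.
Proof.
move=> mA AB; pose w : R := (#|I|%:R^-1)%R.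
have w0 : (0 <= w)%R by rewrite invr_ge0.
have mf i : measurable_fun setT (fun x => (w * \1_(A i) x)%:E).
  by apply/measurable_EFinP; apply: measurable_funM.
have f0 i x : 0 <= (w * \1_(A i) x)%:E by rewrite lee_fin mulr_ge0.
have -> : \sum_i w%:E * mu (A i) = \int[mu]_x \sum_i (w * \1_(A i) x)%:E.
  rewrite ge0_integral_sum//; apply: eq_bigr => i _.
  under eq_integral do rewrite EFinM.
  rewrite ge0_integralZl_EFin//; last by apply/measurable_EFinP.
  by rewrite integral_indic// setIT.
have -> : B%:E = \int[mu]_x (cst B%:E x).
  rewrite integral_cst// -[LHS]mule1; congr (_ * _); exact/esym/probability_setT.
apply: ge0_le_integral => //.
- by move=> x _; exact: sume_ge0.
- exact: emeasurable_sum.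
- by move=> x _; rewrite sumEFin lee_fin -mulr_sumr mulrC; exact: AB.
Qed.

Lemma success_probability_le (R : realType) (d : measure_display)
    (Om : measurableType d) (P : probability Om R) (k n m : nat) (eta nu B : R)
    (f : rdgraph Om -> bool) :
  measurable_output k n m f ->
  (forall phi, avg (fun Phi : formula k n m =>
     (eta_nu_satisfies eta nu (algorithm_output f Phi phi) Phi)%:R : R) <= B)%R ->
  success_probability P k n m eta nu f <= B%:E.
Proof.
move=> mf PB; apply: average_measure_le => [Phi|phi]; last first.
  apply: le_trans (PB phi); apply: le_avg => Phi; rewrite indicE.
  by rewrite mem_setE.
pose good := [set x : assignment n | eta_nu_satisfies eta nu x Phi].
rewrite (_ : [set _ | _] = \bigcup_(x in good) \bigcap_(i in [set: 'I_n])
    [set phi | algorithm_output f Phi phi i = x i]).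
  apply: fin_bigcup_measurable => // x _; apply: fin_bigcap_measurable => // i _.
  have := mf Phi i measurableT [set x i] I; rewrite setTI; apply.
apply/seteqP; split => [phi /= h|phi /= [x gx hx]].
  by exists (algorithm_output f Phi phi).
suff -> : algorithm_output f Phi phi = x by [].
by apply/ffunP => i; exact: hx.
Qed.

End measure_average.

Section parameters.
Context {R : realType}.

Lemma kappa_star_lt (kappa : R) : kappa_star < kappa ->
  exists2 beta : R, 1 < beta &
    0 < 1 - beta * expR (1 - beta) /\ beta < kappa * (1 - beta * expR (1 - beta)).
Proof.
move=> hk; apply/not_exists2P => H.
suff : kappa <= kappa_star by rewrite leNgt hk.
apply: lb_le_inf; first by exists (iota_fun 2), 2 => //=; rewrite ltr1n.
move=> _ [b /= b1 <-]; rewrite /iota_fun opprB.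
have gamma0 : 0 < 1 - b * expR (1 - b).
  have b0 : 0 < b by lra.
  rewrite subr_gt0 -ltr_pdivlMl// mulr1 -ltf_pV2 ?posrE ?expR_gt0 ?invr_gt0//.
  rewrite invrK -expRN opprB; have := @expR_gt1Dx R (b - 1).
  rewrite subr_eq0 gt_eqF// => /(_ isT).
  by rewrite addrC subrK.
rewrite ler_pdivlMr// leNgt; apply/negP => h.
by have [|] := H b; [rewrite b1|case].
Qed.

Lemma large_k (kappa beta gam g : R) :
  1 < beta -> 0 < kappa -> 0 < gam -> gam <= 1 -> g = kappa * gam - beta -> 0 < g ->
  exists2 a0 : R, 1 <= a0 & forall (k : nat) (Lk : R), a0 <= ln k%:R ->
  Lk <= 8 / g * (k%:R / ln k%:R) + 1 -> 0 <= Lk ->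
  [/\ 0 <= gam - Lk / k%:R * expR 2,
      gam - Lk / k%:R * expR 2 <= 1 &
      (beta + g / 4) * ln k.+2%:R + 2 * kappa * (ln k%:R / k%:R) ^+ 2
      - (1 - k%:R^-1) * (kappa * ln k%:R * (gam - Lk / k%:R * expR 2))
      <= - (g / 4 * ln k%:R)].
Proof.
move=> beta1 kappa0 gam0 gam1 gE g0.
pose M : R := expR 2 * (8 / g + 1).
have M0 : 0 < M by rewrite mulr_gt0 ?expR_gt0// addr_gt0// divr_gt0.
pose C' : R := 2 * (beta + g / 4) + 3 * kappa + kappa * M.
exists (Num.max 1 (Num.max (M / gam) (2 * C' / g))); first by rewrite le_max lexx.
move=> k Lk; rewrite !ge_max => /andP[a1 /andP[aM aC]] LkU Lk0.
set a := ln k%:R in a1 aM aC LkU *.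
have a0 : 0 < a by lra.
have k0 : (0 < k)%N.
  by rewrite lt0n; apply/eqP => k0; move: a0; rewrite /a k0 ln0// ltxx.
have kR0 : (0 : R) < k%:R by rewrite ltr0n.
have ak : a <= k%:R.
  rewrite -[leRHS](@lnK R) ?posrE// -/a.
  by apply: le_trans (expR_ge1Dx _); rewrite lerDr.
have kinv : k%:R^-1 <= a^-1 :> R by rewrite lef_pV2 ?posrE.
have inv1 : k%:R^-1 <= 1 :> R by rewrite invf_le1// ler1n.
have kinv0 : 0 < k%:R^-1 :> R by rewrite invr_gt0.
have ainv0 : 0 < a^-1 by rewrite invr_gt0.
have LMa : Lk / k%:R * expR 2 <= M / a.
  have : Lk / k%:R <= (8 / g + 1) / a.
    apply: le_trans (ler_wpM2r (ltW kinv0) LkU) _.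
    have -> : (8 / g * (k%:R / a) + 1) / k%:R = 8 / g / a + k%:R^-1.
      by field; rewrite !gt_eqF.
    by rewrite [leRHS]mulrDl [X in _ <= _ + X]mul1r lerD2l.
  move=> /(ler_wpM2r (expR_ge0 2)); rewrite /M; move=> h; apply: le_trans h _.
  by rewrite le_eqVlt; apply/orP; left; apply/eqP; ring.
set rg := gam - Lk / k%:R * expR 2.
have rg0 : 0 <= rg.
  rewrite subr_ge0 (le_trans LMa)// ler_pdivrMr// -ler_pdivrMl// mulrC.
  by [].
have rg1 : rg <= 1.
  have : 0 <= Lk / k%:R * expR 2 by rewrite mulr_ge0 ?expR_ge0// divr_ge0// ltW.
  rewrite /rg; lra.
split=> //.
have B2 : ln k.+2%:R <= a + 2.
  have -> : k.+2%:R = k%:R * (1 + 2 / k%:R) :> R.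
    by rewrite mulrDr mulr1 mulrCA divff ?gt_eqF// mulr1 -natrD addn2.
  have s0 : 0 < 1 + 2 / k%:R :> R by rewrite addr_gt0// divr_gt0.
  rewrite lnM ?posrE//.
  rewrite lerD2l; apply: le_trans (le_ln1Dx _) _.
    by rewrite (lt_trans (ltrN10 _))// divr_gt0.
  by rewrite ler_pdivrMr// ler_pMr// ler1n.
have t1 : (beta + g / 4) * ln k.+2%:R <= (beta + g / 4) * (a + 2).
  by rewrite ler_wpM2l//; lra.
have ak1 : a / k%:R <= 1 by rewrite ler_pdivrMr// mul1r.
have ak0 : 0 <= a / k%:R by rewrite divr_ge0// ltW.
have t2 : 2 * kappa * (a / k%:R) ^+ 2 <= 2 * kappa.
  by rewrite ger_pMr ?mulr_gt0// exprn_ile1.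
have t3 : kappa * a * (gam - M / a) <= kappa * a * rg.
  by rewrite ler_wpM2l ?lerD2l ?lerN2// mulr_ge0// ltW.
have t3E : kappa * a * (gam - M / a) = kappa * gam * a - kappa * M.
  by field; rewrite gt_eqF.
have t4 : k%:R^-1 * (kappa * a * rg) <= kappa.
  have -> : k%:R^-1 * (kappa * a * rg) = kappa * (a / k%:R * rg) by ring.
  by rewrite ger_pMr// mulr_ile1.
have C'a : C' <= g * a / 2.
  by move: aC; rewrite ler_pdivrMr//; lra.
move: C'a; rewrite /C' mulrBl mul1r; move: t1 t2 t3 t4; rewrite t3E gE => *.
lra.
Qed.

End parameters.

Lemma exponent_one_rung (R : realType) (v X z z' cn wn : R) : 0 <= X ->
  v + 2 * X - z' <= - wn + 1 -> z' <= z -> cn <= wn -> v + (X - z) <= 1 - cn.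
Proof. by move=> *; lra. Qed.

Lemma exponent_all_rungs (R : realType) (l v X Z w n c s : R) :
  s <= l * (2 * X) -> l * (v + 2 * X - Z) <= l * (- (w * n) + 1) ->
  2 * n <= l * w * n -> c * n <= 1 / 2 * n -> 0 < n ->
  n + (l * v + (s - l * Z)) <= l - c * n.
Proof. by rewrite !(mulrDr, mulrN) mulr1 => *; lra. Qed.

Section fixed_clause_size.
Context {R : realType}.
Variables (kappa beta g : R) (k L : nat).
Hypotheses (kappa_gt0 : 0 < kappa) (beta_gt1 : 1 < beta) (g_gt0 : 0 < g).
Hypotheses (lnk_ge1 : 1 <= ln k%:R :> R) (L_gt0 : (0 < L)%N).

Let a : R := ln k%:R.
Let rg : R := 1 - beta * expR (1 - beta) - L%:R / k%:R * expR 2.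
Let alpha : R := kappa * 2 ^+ k * ln k%:R / k%:R.
Let nu : R := (k%:R ^+ 2 * 2 ^+ k)^-1.
Let eta : R := g / 4 / (4 * k%:R).

Hypotheses (rg_ge0 : 0 <= rg) (rg_le1 : rg <= 1).
Hypothesis rg_gain : (beta + g / 4) * ln k.+2%:R + 2 * kappa * (a / k%:R) ^+ 2
  - (1 - k%:R^-1) * (kappa * a * rg) <= - (g / 4 * a).
Hypothesis L_large : 2 <= L%:R * (g / 4 * (a / k%:R)).

Let k_gt0 : (0 < k)%N.
Proof.
rewrite lt0n; apply/eqP => k0.
by have := lnk_ge1; rewrite k0 ln0// ler10.
Qed.

Let kR0 : (0 : R) < k%:R. Proof. by rewrite ltr0n. Qed.

Let alpha_ge0 : 0 <= alpha.
Proof.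
by rewrite divr_ge0// ?ler0n// mulr_ge0 ?mulr_ge0 ?exprn_ge0 ?ler0n ?(ltW kappa_gt0)//
  (le_trans ler01).
Qed.

Lemma rung_exponent (n m : nat) :
  m%:R <= alpha * n%:R -> alpha * n%:R <= m%:R + 1 ->
  (beta + g / 4) * ln k.+2%:R / k%:R * n%:R + 2 * (a * (nu * m%:R)) -
    (1 - k%:R^-1) * (m%:R * (2^-1 ^+ k * rg)) <= - (g / 4 * (a / k%:R) * n%:R) + 1.
Proof.
move=> mU mL.
have two0 : (0 : R) < 2 ^+ k by rewrite exprn_gt0.
have a0 : 0 < a by rewrite (lt_le_trans ltr01).
have X : a * (nu * m%:R) <= kappa * (a / k%:R) ^+ 2 / k%:R * n%:R.
  have -> : kappa * (a / k%:R) ^+ 2 / k%:R * n%:R = a * (nu * (alpha * n%:R)).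
    by rewrite /nu /alpha -/a; field; rewrite !gt_eqF.
  by rewrite !ler_wpM2l// ?(ltW a0)// invr_ge0 mulr_ge0 ?exprn_ge0.
have inv1 : k%:R^-1 <= 1 :> R by rewrite invf_le1// ler1n.
have inv0 : 0 < k%:R^-1 :> R by rewrite invr_gt0.
have Y : kappa * (a / k%:R) * n%:R - 1 <= m%:R * 2^-1 ^+ k.
  have -> : kappa * (a / k%:R) * n%:R = alpha * n%:R * 2^-1 ^+ k.
    rewrite /alpha -/a exprVn; field; rewrite !gt_eqF//.
  have h : 2^-1 ^+ k <= 1 :> R by rewrite exprn_ile1// invf_le1// ler1n.
  have h0 : 0 <= 2^-1 ^+ k :> R by rewrite exprn_ge0.
  have := ler_wpM2r h0 mL; rewrite mulrDl mul1r; lra.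
have c0 : 0 <= (1 - k%:R^-1) * rg by rewrite mulr_ge0// subr_ge0.
have c1 : (1 - k%:R^-1) * rg <= 1 by rewrite mulr_ile1//; lra.
have Z := ler_wpM2r c0 Y.
have gain := ler_wpM2r (mulr_ge0 (ltW inv0) (ler0n R n)) rg_gain.
have e1 : m%:R * 2^-1 ^+ k * ((1 - k%:R^-1) * rg) =
    (1 - k%:R^-1) * (m%:R * (2^-1 ^+ k * rg)) by ring.
rewrite e1 in Z; move: Z gain.
set p1 := (1 - k%:R^-1) * (m%:R * _).
have -> : (kappa * (a / k%:R) * n%:R - 1) * ((1 - k%:R^-1) * rg) =
  (1 - k%:R^-1) * (kappa * a * rg) * (k%:R^-1 * n%:R) - (1 - k%:R^-1) * rg by ring.
have -> : - (g / 4 * a) * (k%:R^-1 * n%:R) = - (g / 4 * (a / k%:R) * n%:R) by ring.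
have -> : ((beta + g / 4) * ln k.+2%:R + 2 * kappa * (a / k%:R) ^+ 2 -
    (1 - k%:R^-1) * (kappa * a * rg)) * (k%:R^-1 * n%:R) =
  (beta + g / 4) * ln k.+2%:R / k%:R * n%:R +
  2 * (kappa * (a / k%:R) ^+ 2 / k%:R * n%:R) -
  (1 - k%:R^-1) * (kappa * a * rg) * (k%:R^-1 * n%:R) by ring.
lra.
Qed.

Lemma local_success_bound (r : nat) :
  exists2 c : R, 0 < c & exists2 nstar : nat, (0 < nstar)%N &
  forall n, (nstar <= n)%N -> let m := Num.truncn (alpha * n%:R) in
  forall A : formula k n m -> assignment n,
  (forall (Phi Phi' : formula k n m) (ch : pred 'I_m) (S0 : {set 'I_n}) i,
    (forall j, ~~ ch j -> tnth Phi j = tnth Phi' j) ->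
    (forall j s, ch j -> clause_var Phi (j, s) \in S0) ->
    (forall j s, ch j -> clause_var Phi' (j, s) \in S0) ->
    i \notin iter r (nbr Phi) S0 -> i \notin iter r (nbr Phi') S0 ->
    A Phi i = A Phi' i) ->
  avg (fun Phi => (eta_nu_satisfies eta nu (A Phi) Phi)%:R : R) <= expR (- (c * n%:R)).
Proof.
have a0 : 0 < a by rewrite (lt_le_trans ltr01).
pose eps : R := g / 4 / (2 * k%:R).
have eps0 : 0 < eps / 2 by rewrite !divr_gt0// mulr_gt0.
have [sg sg0 Hexp] := expansion (k := k) r alpha_ge0 eps0.
pose K := Num.truncn (4 * k%:R * alpha / sg).
pose npred : R := #|{ffun {ffun 'I_L -> bool} -> 'I_k.+1}|%:R.
pose T := (L * K.+1).+1.
pose H : R := #|{: 'I_T * {l : 'I_L.+1 & l.-tuple 'I_T}}|%:R.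
pose Cst : R := H * (npred * expR 1) + T%:R ^+ L.+1 * (npred ^+ L * expR L%:R) +
  T%:R * r%:R.
have npred0 : 0 <= npred by rewrite ler0n.
pose c1 := Num.min (g / 4 * (a / k%:R)) (1 / 2).
have c10 : 0 < c1 by rewrite lt_min mulr_gt0 ?divr_gt0.
pose N0 := (L.+1 ^ K.+1)%N.
have N00 : (0 < N0)%N by rewrite expn_gt0.
exists (c1 / 2 / N0%:R); first by rewrite !divr_gt0// ltr0n.
exists (maxn 1 (maxn (Num.truncn (4 * k%:R / sg)).+1 (Num.truncn (2 * Cst / c1)).+1)).
  by rewrite leq_max.
have lt_trunc (x : R) n : (Num.truncn x < n)%N -> x <= n%:R.
  move=> xn; rewrite ltW//; have [x0|x0] := leP 0 x.
    by rewrite -truncn_lt_nat.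
  by rewrite (lt_le_trans x0).
move=> n; rewrite !geq_max => /andP[n0 /andP[/lt_trunc nsg /lt_trunc nC]] m A A_local.
have nR0 : (0 : R) < n%:R by rewrite ltr0n.
have an0 : 0 <= alpha * n%:R by rewrite mulr_ge0.
have mU : m%:R <= alpha * n%:R by rewrite truncn_le.
have mL : alpha * n%:R <= m%:R + 1.
  by have /andP[_ /ltW] := truncn_itv an0; rewrite -/m natr1.
pose vm : R := beta * ln k.+2%:R / k%:R * n%:R.
pose vp : R := (beta + g / 4) * ln k.+2%:R / k%:R * n%:R.
have B1 : 1 <= ln k.+2%:R :> R.
  by apply: le_trans lnk_ge1 _; rewrite ler_ln ?posrE ?ltr0n// ler_nat -addn2 leq_addr.
have vpE : vp = vm + ln k.+2%:R * ((2 * eta + eps) * n%:R).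
  by rewrite /vp /vm /eta /eps; field; rewrite gt_eqF.
have Ksg : (2 * k * (m %/ K.+1).+1)%:R <= sg * n%:R.
  rewrite !natrM -[(_ %/ _).+1%:R]natr1 mulrDr mulr1.
  have Kl : 4 * k%:R * alpha <= sg * K.+1%:R.
    by rewrite [leRHS]mulrC -ler_pdivrMr//; apply: lt_trunc.
  have mK : (m %/ K.+1)%:R * K.+1%:R <= alpha * n%:R.
    by apply: le_trans mU; rewrite -natrM ler_nat leq_trunc_div.
  have K0 : (0 : R) < K.+1%:R by rewrite ltr0n.
  have h1 : 2 * k%:R * (m %/ K.+1)%:R <= sg * n%:R / 2.
    rewrite -(ler_pM2r K0).
    have := ler_wpM2l (mulr_ge0 (ler0n R 2) (ltW kR0)) mK.
    have := ler_wpM2r (ltW nR0) Kl.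
    by lra.
  have h2 : 4 * k%:R <= sg * n%:R by rewrite [leRHS]mulrC -ler_pdivrMr.
  by lra.
have vm_ge : n%:R / k.+1%:R <= vm.
  rewrite /vm [leRHS]mulrC ler_wpM2l// mulrAC.
  apply: (@le_trans _ _ (1 / k%:R)).
    by rewrite mul1r lef_pV2 ?posrE ?ltr0n// ler_nat.
  rewrite mulrAC ler_wpM2r ?invr_ge0//.
  by rewrite -[leLHS]mul1r ler_pM// ltW.
have vmvp : vm <= vp.
  rewrite vpE lerDl mulr_ge0 ?(le_trans ler01 B1)// mulr_ge0//.
  by rewrite addr_ge0 ?mulr_ge0// /eta ?divr_ge0 ?mulr_ge0 ?divr_ge0// ltW.
have vmp : vm + ln k.+2%:R * ((2 * eta + eps) * n%:R) <= vp by rewrite vpE.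
have := @success_bound R k n m K L r k_gt0 n0 A eta nu eps sg a beta vm vp _
  (ltW a0) beta_gt1 (erefl vm) vm_ge vmvp vmp Ksg A_local (Hexp n m n0 mU).
rewrite [expR (- a)]expRN lnK ?posrE// -/npred -/H -/T -/N0 -/rg.
set X := a * (nu * m%:R); set Y := m%:R * 2^-1 ^+ k.
set p := avg _; move=> pb.
have X0 : 0 <= X.
  by rewrite !mulr_ge0 ?(ltW a0)// invr_ge0 mulr_ge0 ?exprn_ge0.
have inv1 : k%:R^-1 <= 1 :> R by rewrite invf_le1// ler1n.
have Y0 : 0 <= Y by rewrite mulr_ge0// exprn_ge0.
have E2 := rung_exponent mU mL.
rewrite -/vp -/X mulrA -/Y in E2.
have c1le x : c1 <= x -> expR (- (x * n%:R)) <= expR (- (c1 * n%:R)).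
  by move=> h; rewrite ler_expR lerN2 ler_wpM2r.
have c1g : c1 <= g / 4 * (a / k%:R) by rewrite ge_min lexx.
have c1h : c1 <= 1 / 2 by rewrite ge_min lexx orbT.
have bound1 : npred * expR vp * expR (X - (1 - k%:R^-1) * Y) <=
    npred * expR 1 * expR (- (c1 * n%:R)).
  rewrite -!mulrA ler_wpM2l// -!expRD ler_expR.
  apply: (exponent_one_rung X0 E2); last by rewrite ler_wpM2r// ltW.
  by rewrite ler_wpM2l ?subr_ge0// ler_piMr.
have bound2 : 2 ^+ n * (npred * expR vp) ^+ L *
      expR (L.+1%:R * X - (1 - k%:R^-1) * (m%:R * (L%:R * (2^-1 ^+ k * rg)))) <=
    npred ^+ L * expR L%:R * expR (- (c1 * n%:R)).
  have two : 2 ^+ n <= expR n%:R :> R.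
    rewrite -[n%:R]mulr1 expRM_natl lerXn2r ?nnegrE ?expR_ge0//.
    by apply: le_trans (expR_ge1Dx 1); rewrite -natr1.
  rewrite exprMn -expRM_natl [2 ^+ n * _]mulrCA -!mulrA ler_wpM2l ?exprn_ge0//.
  apply: le_trans (ler_wpM2r _ two) _; first by rewrite mulr_ge0 ?expR_ge0.
  rewrite -!expRD ler_expR.
  have -> : (1 - k%:R^-1) * (m%:R * (L%:R * (2^-1 ^+ k * rg))) =
      L%:R * ((1 - k%:R^-1) * (Y * rg)) by rewrite /Y; ring.
  have L1 : 1 <= L%:R :> R by rewrite ler1n.
  have h1 : L.+1%:R * X <= L%:R * (2 * X).
    by rewrite -natr1 mulrDl !mulrDl mul1r mulrDr lerD2l ler_peMl.
  apply: (exponent_all_rungs h1 (ler_wpM2l (ler0n R L) E2)) => //.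
    by rewrite ler_wpM2r// ltW.
  by rewrite ler_wpM2r// ltW.
have bound3 : r%:R * expR (- (n%:R / 2)) <= r%:R * expR (- (c1 * n%:R)).
  rewrite ler_wpM2l//; apply: le_trans (c1le _ c1h).
  by rewrite mul1r [_^-1 * _]mulrC.
have p0 : 0 <= p by apply: avg_ge0 => Phi; rewrite ler0n.
have pC : p ^+ N0 <= Cst * expR (- (c1 * n%:R)).
  apply: le_trans pb _; rewrite /Cst [leRHS]mulrDl [X in _ <= X + _]mulrDl.
  apply: lerD; first apply: lerD.
  - by rewrite -[leRHS]mulrA; apply: ler_wpM2l bound1; exact: ler0n.
  - by rewrite -[leRHS]mulrA; apply: ler_wpM2l bound2; exact: exprn_ge0.
  - by rewrite -[leRHS]mulrA; apply: ler_wpM2l bound3; exact: ler0n.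
have Ce : Cst <= expR (c1 / 2 * n%:R).
  apply: le_trans (expR_ge1Dx _).
  have : Cst <= c1 / 2 * n%:R.
    by rewrite -ler_pdivrMl ?divr_gt0// invf_div mulrC mulrA [Cst * _]mulrC.
  by move/le_trans; apply; rewrite lerDr.
have pE : p ^+ N0 <= expR (- (c1 / 2 / N0%:R * n%:R)) ^+ N0.
  apply: le_trans pC _; apply: le_trans (ler_wpM2r (expR_ge0 _) Ce) _.
  rewrite -expRD -expRM_natl ler_expR le_eqVlt; apply/orP; left; apply/eqP.
  by field; rewrite pnatr_eq0 -lt0n.
by move: pE; rewrite ler_pXn2r ?nnegrE ?expR_ge0.
Qed.

End fixed_clause_size.

Local Open Scope classical_set_scope.
Local Open Scope ring_scope.

Theorem theorem2p13 (R : realType) :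
  exists C : nat,
  forall kappa : R, kappa_star < kappa ->
  exists c0 : R, 0 < c0 /\
  exists kstar : nat, (0 < kstar)%N /\
  forall k : nat, (kstar <= k)%N ->
  exists eta : R, c0 / k%:R ^+ 2 <= eta /\
  let nu : R := (k%:R ^+ 2 * 2 ^+ k)^-1 in
  let alpha : R := kappa * 2 ^+ k * ln k%:R / k%:R in
  forall r : nat,
  exists c : R, 0 < c /\
  exists nstar : nat, (0 < nstar)%N /\
  forall n : nat, (nstar <= n)%N ->
  let m : nat := Num.truncn (alpha * n%:R) in
  forall (d : measure_display) (Om : measurableType d) (P : probability Om R)
    (f : rdgraph Om -> bool),
    r_local r f -> measurable_output k n m f ->
    (success_probability P k n m eta nu f
      <= (expR (- (c * (n%:R `^ (3^-1)) / (ln n%:R) ^+ C)))%:E)%E.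
Proof.
exists 0%N => kappa /kappa_star_lt[beta beta1 [gam0 gamk]].
set gam := 1 - beta * expR (1 - beta) in gam0 gamk.
have kappa0 : 0 < kappa by rewrite -(pmulr_lgt0 _ gam0); lra.
have gam1 : gam <= 1.
  have : 0 <= beta * expR (1 - beta) by rewrite mulr_ge0 ?expR_ge0//; lra.
  by rewrite /gam; lra.
pose g := kappa * gam - beta.
have g0 : 0 < g by rewrite subr_gt0.
have [a0 a01 large] := large_k beta1 kappa0 gam0 gam1 (erefl g) g0.
exists (g / 16); split; first by rewrite divr_gt0.
exists (Num.truncn (expR a0)).+1; split=> // k kk.
have ak : a0 <= ln k%:R.
  have : expR a0 <= k%:R by rewrite ltW// -truncn_lt_nat ?expR_ge0.
  have k0 : (0 : R) < k%:R by rewrite ltr0n (leq_trans _ kk).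
  by move=> h; rewrite -[leLHS]expRK ler_ln ?posrE ?expR_gt0.
have k1 : (1 : R) <= k%:R by rewrite ler1n (leq_trans _ kk).
have k0 : (0 : R) < k%:R by lra.
have lnk1 : 1 <= ln k%:R :> R by apply: le_trans ak.
pose x : R := 8 / g * (k%:R / ln k%:R).
have x0 : 0 <= x by rewrite mulr_ge0 ?divr_ge0 ?(ltW g0)// ltW// (lt_le_trans ltr01).
pose L := (Num.truncn x).+1.
have /andP[xl /ltW xu] := truncn_itv x0.
have LU : L%:R <= x + 1 by rewrite -natr1 lerD2r.
have [rg0 rg1 gain] := large k L%:R ak LU (ler0n _ _).
have Ll : 2 <= L%:R * (g / 4 * (ln k%:R / k%:R)).
  have c0 : 0 <= g / 4 * (ln k%:R / k%:R).
    by rewrite mulr_ge0 ?divr_ge0 ?(ltW g0) ?(ltW k0)// (le_trans ler01).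
  have := ler_wpM2r c0 xu; congr (_ <= _); rewrite /x; field.
  by rewrite !gt_eqF// (lt_le_trans ltr01).
exists (g / 4 / (4 * k%:R)); split.
  rewrite -subr_ge0.
  have -> : g / 4 / (4 * k%:R) - g / 16 / k%:R ^+ 2 =
      g / 16 / k%:R ^+ 2 * (k%:R - 1) by field; rewrite gt_eqF.
  by rewrite mulr_ge0 ?subr_ge0// !divr_ge0 ?exprn_ge0// ltW.
move=> nu alpha r.
have [c c0 [nstar nstar0 bound]] :=
  local_success_bound kappa0 beta1 g0 lnk1 (ltn0Sn _ : (0 < L)%N) rg0 rg1 gain Ll r.
exists c; split=> //; exists nstar; split=> // n nn m d Om P f floc fmeas.
apply: (@le_trans _ _ (expR (- (c * n%:R)))%:E).
  apply: success_probability_le => // phi; apply: bound => //.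
  by move=> Phi Phi' ch S0 i; exact: local_output.
have n1 : (1 : R) <= n%:R by rewrite ler1n (leq_trans nstar0).
rewrite lee_fin ler_expR lerN2 expr0 divr1 ler_wpM2l ?(ltW c0)//.
rewrite -[leRHS]powRr1 ?(le_trans ler01)// ler_powR// invf_le1// ler1n.
by [].
Qed.
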